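(* Let $\omega_0\in H^1(\mathbb{R})$ satisfy: (1) $\omega_0$ is an odd function of $x$; (2) $x=0$ is the unique zero of $\omega_0$, and $\operatorname{sgn}(\omega_0(x))=-\operatorname{sgn}(x)$; (3) there is a positive integer $n\ge 1$ such that $\omega_0\in C^{2n+3}(-\delta,\delta)$ for some $\delta>0$, and $$\omega_0^{(k)}(0)=0,\quad k=0,1,\dots,2n,\qquad \omega_0^{(2n+1)}(0)<0.$$ Let $\omega(x,t)$ be the solution of $\omega_t=\omega\,\mathbf{H}(\omega)$ on $\mathbb{R}$ with $\omega(x,0)=\omega_0(x)$. Then $\mathbf{H}(\omega_0)(0)>0$ and $\mathbf{H}(\omega_0)''(0)>0$. Further write $$\mathbf{H}(\omega_0)(0)=2a,\qquad \mathbf{H}(\omega_0)''(0)=4b,\qquad \omega_0^{(2n+1)}(0)=-4c\,(2n+1)!\,,$$ with $a,b,c>0$, and let $$T=\frac1a,\qquad \Omega_{2,n}(z)=-\frac{a^{2n+1}b^{(2n+1)/2}c}{a^{4n}c^2+b^{2n+2}z^2},\qquad \mathbf{H}(\Omega_{2,n})(z)=-\frac{a\,b^{(4n+3)/2}z}{a^{4n}c^2+b^{2n+2}z^2}.$$ Then there exist $t_0\in(0,T)$ and a function $r\in C^1([t_0,T])$ with $$r(T)=\frac{a}{b^{1/2}},$$ such that, as $t\to T^-$, for $x=r(t)(T-t)^{1/2}+O((T-t)^n)$, $$\omega(x,t)=\frac{1}{(T-t)^{(2n+1)/2}}\left(\Omega_{2,n}\!\left(\frac{x-r(t)(T-t)^{1/2}}{(T-t)^n}\right)+O\big((T-t)^{1/2}\big)\right),$$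 $$\mathbf{H}(\omega)(x,t)=\frac{1}{(T-t)^{(2n+1)/2}}\left(\mathbf{H}(\Omega_{2,n})\!\left(\frac{x-r(t)(T-t)^{1/2}}{(T-t)^n}\right)+O\big((T-t)^{1/2}\big)\right).$$
   Context: $\mathbf{H}$ denotes the Hilbert transform on $\mathbb{R}$ (acting in the variable $x$), with the sign convention $\mathbf{H}(f)(x)=\frac1\pi\,\mathrm{p.v.}\!\int_{\mathbb{R}}\frac{f(y)}{x-y}\,dy$, so that $\mathbf{H}(f)(0)=-\frac1\pi\,\mathrm{p.v.}\!\int_{\mathbb{R}} \frac{f(y)}{y}\,dy$. The equation $\omega_t=\omega\,\mathbf{H}(\omega)$ is the Constantin--Lax--Majda (CLM) model. Its solution with initial data $\omega_0\in H^1(\mathbb{R})$ (for times before blowup) is the one given by the known explicit formula of Constantin--Lax--Majda: $$\omega(x,t)=\frac{4\omega_0(x)}{(2-t\mathbf{H}(\omega_0)(x))^2+t^2\omega_0(x)^2},\qquad \mathbf{H}(\omega)(x,t)=\frac{2\mathbf{H}(\omega_0)(x)(2-t\mathbf{H}(\omega_0)(x))-2t\,\omega_0(x)^2}{(2-t\mathbf{H}(\omega_0)(x))^2+t^2\omega_0(x)^2}.$$ The phrase ''as $t\to T^-$, for $x=r(t)(T-t)^{1/2}+O((T-t)^n)$, [formula with error $O((T-t)^{1/2})$]'' means: for every $M>0$ there are $C>0$ and $t_1<T$ such that the error terms are bounded in absolute value by $C(T-t)^{1/2}$ for all $t\in[t_1,T)$ and all $x$ with $|x-r(t)(T-t)^{1/2}|\le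 M(T-t)^n$. *)

(* Defs.v *)
From HB Require Import structures.
From mathcomp Require Import all_boot all_order all_algebra.
From mathcomp Require Import all_classical all_reals all_analysis.

Set Implicit Arguments.
Unset Strict Implicit.
Unset Printing Implicit Defensive.

Import Order.TTheory GRing.Theory Num.Theory.
Import numFieldNormedType.Exports.

Local Open Scope ring_scope.
Local Open Scope classical_set_scope.

(* [C^k] on an open set [A]. *)
Definition Ck_on (R : realType) (k : nat) (A : set R) (f : R -> R) : Prop :=
  (forall j : nat, (j < k)%N -> forall x : R, A x -> derivable (f^`(j)) x 1) /\
  (forall x : R, A x -> {for x, continuous (f^`(k))}).

(* [C^1] up to the end points: the derivative is the limit of difference
   quotients within [[s, t]], hence one-sided at [s] and [t]. *)
Definition C1_itv (R : realType) (s t : R) (f : R -> R) : Prop :=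
  exists2 df : R -> R,
    {within `[s, t], continuous df} &
    forall x : R, `[s, t] x ->
      (f y - f x) / (y - x) @[y --> within `[s, t] x^'] --> df x.

Definition test_function (R : realType) (phi : R -> R) : Prop :=
  (forall (k : nat) (x : R), derivable (phi^`(k)) x 1) /\
  (exists M : R, forall x : R, M < `|x| -> phi x = 0).

Definition weak_derivative (R : realType) (f g : R -> R) : Prop :=
  forall phi : R -> R, test_function phi ->
    \int[@lebesgue_measure R]_x (f x * derive1 phi x) =
    - \int[@lebesgue_measure R]_x (g x * phi x).

(* Elements of [H^1] are classes of functions modulo null sets; as usual in
   dimension one, [f] stands for the unique continuous representative, so
   that its pointwise values make sense. *)
Definition sobolev_H1 (R : realType) (f : R -> R) : Prop :=
  [/\ continuous f,
      f \in Lfun (@lebesgue_measure R) 2%:E &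
      exists2 g : R -> R,
        g \in Lfun (@lebesgue_measure R) 2%:E & weak_derivative f g].

(* The principal value truncates around [y = x] only: for [f] in [L^2] the
   truncated integrals converge absolutely at infinity. If the limit does not
   exist, [lim] returns [0]. *)
Definition hilbert (R : realType) (f : R -> R) (x : R) : R :=
  pi^-1 * lim ((fun e : R =>
    \int[@lebesgue_measure R]_(y in [set y : R | (e < `|x - y|)%R])
      (f y / (x - y))) @ 0^'+).

Definition clm_denominator (R : realType) (w0 : R -> R) (x t : R) : R :=
  (2 - t * hilbert w0 x) ^+ 2 + t ^+ 2 * w0 x ^+ 2.

(* [w x t] is the Constantin-Lax-Majda solution of [w_t = w H(w)] on [[0, T)]
   with initial data [w0]. The explicit formulas select the solution; the
   second one is about the actual Hilbert transform of [w^~ t]. *)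
Record clm_solution (R : realType) (w0 : R -> R) (T : R) (w : R -> R -> R) :
    Prop := ClmSolution {
  clm_initial : forall x : R, w x 0 = w0 x ;
  clm_equation : forall x t : R, 0 < t < T ->
    is_derive t 1 (w x) (w x t * hilbert (w^~ t) x) ;
  clm_formula : forall x t : R, 0 <= t < T ->
    w x t = 4 * w0 x / clm_denominator w0 x t ;
  clm_hilbert_formula : forall x t : R, 0 <= t < T ->
    hilbert (w^~ t) x =
      (2 * hilbert w0 x * (2 - t * hilbert w0 x) - 2 * t * w0 x ^+ 2)
      / clm_denominator w0 x t
}.

Definition Omega2 (R : realType) (a b c : R) (n : nat) (z : R) : R :=
  - (a ^+ (2 * n + 1) * b `^ ((2 * n + 1)%:R / 2) * c
     / (a ^+ (4 * n) * c ^+ 2 + b ^+ (2 * n + 2) * z ^+ 2)).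

(* As [t] tends to [T] from the left, for
   [x = r(t) (T - t)^(1/2) + O((T - t)^n)],
   [u x t = (T - t)^(-(2n+1)/2)
            (U ((x - r(t) (T - t)^(1/2)) / (T - t)^n) + O((T - t)^(1/2)))]. *)
Definition profile_asymptotics (R : realType) (t0 T : R) (n : nat) (r : R -> R)
    (u : R -> R -> R) (U : R -> R) : Prop :=
  forall M : R, 0 < M ->
  exists C t1 : R, [/\ 0 < C, t0 <= t1, t1 < T &
    forall t x : R, t1 <= t < T ->
      `|x - r t * (T - t) `^ (1 / 2)| <= M * (T - t) ^+ n ->
      exists2 E : R, `|E| <= C * (T - t) `^ (1 / 2) &
        u x t = 1 / (T - t) `^ ((2 * n + 1)%:R / 2) *
                (U ((x - r t * (T - t) `^ (1 / 2)) / (T - t) ^+ n) + E)].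

(* Main.v *)
Require Import Defs.
From HB Require Import structures.
From mathcomp Require Import all_boot all_order all_algebra.
From mathcomp Require Import all_classical all_reals all_analysis.
From mathcomp Require Import measurable_realfun zify ring lra.

Set Implicit Arguments.
Unset Strict Implicit.
Unset Printing Implicit Defensive.

Import Order.TTheory GRing.Theory Num.Theory.
Import numFieldNormedType.Exports.

Local Open Scope ring_scope.
Local Open Scope classical_set_scope.

(** Write [m = 2n + 1], [T = 1 / a]. Expanding
    [1 / (x - y) = - sum_(j < m) x^j / y^(j+1) + x^m / (y^m (x - y))] under the
    principal value gives, near [0], [H(w0)(x) = P(x^2) + x^m K(x)] with [P] a
    polynomial whose coefficients are moments of [- w0], hence positive, and
    [K] the Hilbert transform of [w0 / y^m]. The latter function is even with a
    Lipschitz derivative near [0], so [K] is differentiable and [K(0) = 0]: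
    near [0], [H(w0)] is the even polynomial [P(x^2)] up to [O(x^(m+1))].
    An approximate zero [x = r(t) (T - t)^(1/2)] of [2 - t H(w0)(x)] is then
    accurate enough, and one is given by [r^2 = rho(T - t)] for a polynomial
    [rho]. With [s = (T - t)^(1/2)] and [x = r s + z s^(2n)] one finds
    [2 - t H(w0)(x) = - 4 b^(1/2) z s^m + O(s^(m+1))] and
    [t w0(x) = - 4 c a^(2n) b^(- m/2) s^m + O(s^(m+1))]; inserting this in the
    explicit formulas yields the two profiles. *)

(** * Truncated integrals *)

(** The profile sits at the scale [s ^+ m] of [2 - t H(w0)(x)], so whatever is not explicit has to
    be of order [s ^+ m.+1]. Oddness makes the derivative of [w0] of order [m + 1] vanish at [0];
    the [2n + 3 = m + 2] derivatives then leave [w0 / y^m] with a Lipschitz derivative. This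
    suffices for [K] to be differentiable, and [K 0 = 0], again by parity, supplies the missing
    factor [x]. Parity acts once more on the zero: with even powers only, its equation relates
    [x ^+ 2] to [tau = T - t], so [rho] is a polynomial in [tau] and not in [tau^(1/2)]. As
    [rho.[0]] is positive, [r] is [C^1] up to [T]. To lowest order the equation reads
    [2 a tau = (2 b / a) x^2], which is the origin of [r(T) = a / b^(1/2)]. An approximate zero
    avoids any implicit function argument, for its error [tau^(n+1) = s^(m+1)] is no larger than the
    terms neglected anyway. All estimates are uniform in [z], because the rescaled denominator tends
    to a sum of squares one of which is a positive constant. *)

Section Truncation.
Context {R : realType}.
Notation mu := (@lebesgue_measure R).

(** The reciprocal is written as [f] times the power [-1] of [f ^+ 2]: the base is nonnegative,
    where [powR] agrees with the inverse, and both sides are [0] where [f] is. *)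
Lemma measurable_inv_fun (D : set R) (f : R -> R) :
  measurable_fun D f -> measurable_fun D (fun x => (f x)^-1).
Proof.
move=> mf.
have -> : (fun x => (f x)^-1) =
    f \* ((fun y : R => y `^ (-1)) \o (fun x => f x ^+ 2)).
  apply/funext => x /=; rewrite powR_inv1 ?sqr_ge0//.
  have [->|fx0] := eqVneq (f x) 0; first by rewrite invr0 mul0r.
  by rewrite expr2 invfM mulrA divff// mul1r.
apply: measurable_funM => //.
apply: measurableT_comp; first exact: measurable_powR.
exact: measurable_funX.
Qed.

Lemma measurable_norm_lt (d : R) : measurable_fun setT (fun y : R => `|y| < d).
Proof.
by apply: measurable_fun_ltr; [exact: normr_measurable|exact: measurable_cst].
Qed.

Definition trunc (x e : R) : set R := [set y | e < `|x - y|].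

Lemma truncE (x e : R) : trunc x e = ~` `[x - e, x + e]%classic.
Proof.
apply/seteqP; split => y /=; rewrite /trunc /= in_itv /=.
  by move=> ey; apply/negP; rewrite -ler_distlC -ltNge.
by move=> /negP; rewrite -ler_distlC -ltNge.
Qed.

Lemma measurable_trunc (x e : R) : measurable (trunc x e).
Proof. by rewrite truncE; exact: measurableC. Qed.

(** Dominated convergence along sequences: a point [y] other than [x] eventually belongs to the
    truncated set, and the point left out is null. *)
Lemma cvg_trunc (g : R -> R) (x : R) :
  mu.-integrable setT (EFin \o g) ->
  \int[mu]_(y in trunc x e) g y @[e --> 0^'+] --> \int[mu]_y g y.
Proof.
move=> ig; apply/cvg_at_rightP => u [u0 ucvg].
under eq_fun do rewrite Rintegral_mkcond.
apply: fine_cvg.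
rewrite /Rintegral fineK; last exact: integrable_fin_num.
have mg : measurable_fun setT g by have /integrableP[/measurable_EFinP] := ig.
have [] := @dominated_convergence _ _ _ mu setT measurableT
   (fun n => EFin \o (g \_ (trunc x (u n)))) (EFin \o g) (EFin \o (fun y => `|g y|)).
- move=> n; apply/measurable_EFinP.
  apply/(measurable_restrictT _ (measurable_trunc x (u n))).
  exact: measurable_funTS.
- exact/measurable_EFinP.
- exists [set x]; split => //; first by rewrite /= lebesgue_measure_set1.
  move=> y /=; apply: contra_notP => xy _.
  apply: cvg_EFin; first exact: nearW.
  apply: cvg_near_cst; near=> n.
  rewrite /= patchE ifT// inE /trunc /=.
  near: n; apply: (cvgr_lt 0) => //.
  by rewrite normr_gt0 subr_eq0; apply/eqP => yx; apply: xy.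
- exact: integrable_norm.
- apply: aeW => /= y n _; rewrite patchE; case: ifP => _ //=.
  by rewrite normr0 lee_fin.
- by move=> _ _.
Unshelve. all: end_near. Qed.

Lemma Rintegral_eq_off (D : set R) (a : R) (f g : R -> R) : measurable D ->
  mu.-integrable D (EFin \o f) -> measurable_fun D g ->
  (forall y, D y -> y <> a -> f y = g y) ->
  \int[mu]_(y in D) f y = \int[mu]_(y in D) g y.
Proof.
move=> mD /integrableP[mf _] mg fg; congr fine; apply: ae_eq_integral => //.
- exact/measurable_EFinP.
- exists [set a]; split => //; first by rewrite /= lebesgue_measure_set1.
  move=> y /=; apply: contra_notP => ya Dy; congr EFin; exact: fg.
Qed.

Lemma Rintegral_oppr (D : set R) (g : R -> R) : measurable D ->
  mu.-integrable (-%R @^-1` D) (EFin \o (fun y => g (- y))) ->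
  measurable_fun setT g ->
  \int[mu]_(y in D) g y = \int[mu]_(y in -%R @^-1` D) g (- y).
Proof.
move=> mD ig mg; congr fine.
have mN : measurable_fun setT (-%R : measurableTypeR R -> measurableTypeR R) by [].
have mEg : measurable_fun setT (EFin \o g) by exact/measurable_EFinP.
have /= <- := integral_pushforward mN mEg ig mD.
by apply: eq_measure_integral => //= A mA AS; exact/esym/lebesgue_measureN.
Qed.

Lemma Rintegral_odd (D : set R) (g : R -> R) : measurable D ->
  mu.-integrable D (EFin \o g) -> measurable_fun setT g ->
  (forall y, D y -> D (- y)) -> (forall y, g (- y) = - g y) ->
  \int[mu]_(y in D) g y = 0.
Proof.
move=> mD ig mg DN gN.
have DE : (-%R : R -> R) @^-1` D = D.
  apply/seteqP; split => y /=; last exact: DN.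
  by move=> /DN; rewrite opprK.
have ig1 : mu.-integrable D (EFin \o (fun y => -1 * g y)).
  by move: ig => /(integrableZl _ (-1)); apply.
have gN1 : (fun y => g (- y)) = (fun y => -1 * g y).
  by apply/funext => y; rewrite gN mulN1r.
have := @Rintegral_oppr D g mD; rewrite DE gN1 => /(_ ig1 mg).
rewrite RintegralZl//; lra.
Qed.

End Truncation.

(** * Differentiation under the integral sign *)

Section Leibniz.
Context {R : realType}.
Notation mu := (@lebesgue_measure R).

(* [derivable_under_integral] requires derivability for every [y]; the principal
   value kernel below is not known to be derivable on the diagonal. *)
Lemma derivable_under_lipschitz (f : R -> R -> R) (G : R -> R) (a r : R) :
  0 < r ->
  (forall x, `|x - a| < r -> mu.-integrable setT (EFin \o f x)) ->
  mu.-integrable setT (EFin \o G) ->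
  (forall x y, `|x - a| < r -> `|f x y - f a y| <= G y * `|x - a|) ->
  (forall y, y <> a -> derivable (f^~ y) a 1) ->
  derivable (fun x => \int[mu]_y f x y) a 1.
Proof.
move=> r0 intf intG Gub df.
(* The difference quotient is cut off so that [G] dominates it at every index of the sequence, not
   only eventually. *)
pose g (t y : R) := if `|t| < r then (f (t + a) y - f a y) * t^-1 else 0.
pose dfa (y : R) := if y == a then 0 else (f^~ y)^`() a.
apply/cvg_ex; exists (\int[mu]_y dfa y); apply/cvgr_dnbhsP => t [t0 tcvg].
have tr : \forall n \near \oo, `|t n| < r by exact: (cvgr0_norm_lt _ tcvg).
have intf0 : mu.-integrable setT (EFin \o f a).
  by apply: intf; rewrite subrr normr0.
have mf x : `|x - a| < r -> measurable_fun setT (f x).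
  by move=> /intf/integrableP[/measurable_EFinP].
have mf0 : measurable_fun setT (f a) by apply: mf; rewrite subrr normr0.
have mg n : measurable_fun setT (g (t n)).
  rewrite /g; have [tn|_] := boolP (`|t n| < r); last exact: measurable_cst.
  apply: measurable_funM => //.
  by apply: measurable_funB => //; apply: mf; rewrite addrK.
have gdf y : y <> a -> g (t n) y @[n --> \oo] --> dfa y.
  move=> ya; rewrite /dfa; have /negbTE -> : y != a by exact/eqP.
  have /cvg_ex[l fl] := df y ya.
  have -> : (f^~ y)^`() a = l.
    by apply/cvg_lim => //; move: fl; under eq_fun do rewrite scaler1.
  move: fl => /cvgr_dnbhsP/(_ t (conj t0 tcvg)) fl.
  apply: cvg_trans fl; apply: near_eq_cvg; near=> n.
  rewrite /g scaler1 ifT; last by near: n.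
  by rewrite mulrC.
have mdfa : measurable_fun setT dfa.
  have mcvg : measurable_fun (~` [set a]) dfa.
    apply: (@measurable_fun_cvg _ _ _ _ (fun n => g (t n))) => [n|y /= ya].
      exact: measurable_funTS.
    exact: gdf.
  rewrite -(setUv [set a]); apply/measurable_funU => //; first exact: measurableC.
  split => //; exact: measurable_fun_set1.
have [] := @dominated_convergence _ _ _ mu setT measurableT
   (fun n => EFin \o g (t n)) (EFin \o dfa) (EFin \o G).
- by move=> n; apply/measurable_EFinP; exact: mg.
- exact/measurable_EFinP.
- exists [set a]; split => //; first by rewrite /= lebesgue_measure_set1.
  move=> y /=; apply: contra_notP => xy _.
  by apply: cvg_EFin; [exact: nearW|exact: gdf].
- exact: intG.
- apply: aeW => /= y n _; rewrite lee_fin /g; case: ifPn => [tn|_].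
    have := Gub (t n + a) y; rewrite addrK => /(_ tn).
    by rewrite normrM normfV ler_pdivrMr ?normr_gt0.
  rewrite normr0.
  (* The Lipschitz bound at a point other than [a] forces [0 <= G y]. *)
  have := Gub (a + r / 2) y; rewrite addrAC subrr add0r ger0_norm; last lra.
  have r2 : r / 2 < r by lra.
  by move=> /(_ r2) /(le_trans (normr_ge0 _)); rewrite pmulr_lge0//; lra.
move=> idfa _ /= gcvg.
have intd n : `|t n| < r -> mu.-integrable setT (EFin \o f (t n + a)).
  by move=> tn; apply: intf; rewrite addrK.
have intB n : `|t n| < r -> mu.-integrable setT
    (EFin \o (fun y => f (t n + a) y - f a y)).
  by move=> /intd tn; exact: (integrableB measurableT tn intf0).
have : \int[mu]_y g (t n) y @[n --> \oo] --> \int[mu]_y dfa y.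
  apply: fine_cvg; rewrite fineK //.
  exact: integrable_fin_num.
apply: cvg_trans; apply: near_eq_cvg; near=> n.
have tn : `|t n| < r by near: n.
rewrite scaler1 -RintegralB//; last exact: intd.
rewrite -[RHS]/(_^-1 * _) mulrC -RintegralZr//; last exact: intB.
by apply: eq_Rintegral => y _; rewrite /g tn.
Unshelve. all: end_near.
Qed.
End Leibniz.

(** * Derivatives, mean values and primitives *)

Section Calculus.
Context {R : realType}.
Notation mu := (@lebesgue_measure R).
Implicit Types (f g : R -> R) (x y a b : R).

(* [is_derive] as a plain predicate: class resolution does not get to choose
   the value of the derivative, which is then found by unification. *)
Definition has_deriv f x a : Prop := is_derive x 1 f a.

Lemma has_deriv_eq f x a b : has_deriv f x a -> a = b -> has_deriv f x b.
Proof. by move=> df <-. Qed.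

Lemma has_deriv_cst a x : has_deriv (fun=> a) x 0.
Proof. exact: is_derive_cst. Qed.

Lemma has_deriv_id x : has_deriv (fun y => y) x 1.
Proof. exact: is_derive_id. Qed.

Lemma has_derivD f g x a b : has_deriv f x a -> has_deriv g x b ->
  has_deriv (fun y => f y + g y) x (a + b).
Proof. by rewrite /has_deriv => df dg; exact: is_deriveD. Qed.

Lemma has_derivN f x a : has_deriv f x a -> has_deriv (fun y => - f y) x (- a).
Proof. by rewrite /has_deriv => df; exact: is_deriveN. Qed.

Lemma has_derivM f g x a b : has_deriv f x a -> has_deriv g x b ->
  has_deriv (fun y => f y * g y) x (f x * b + g x * a).
Proof. by rewrite /has_deriv => df dg; exact: is_deriveM. Qed.

Lemma has_derivV f x a : f x != 0 -> has_deriv f x a ->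
  has_deriv (fun y => (f y)^-1) x (- a / f x ^+ 2).
Proof.
rewrite /has_deriv => fx0 df.
have -> : - a / f x ^+ 2 = - f x ^- 2 *: (a : R^o).
  by rewrite -[RHS]/(_ * _) mulrC mulrN mulNr.
exact: (@is_deriveV R f x a 1 fx0 df).
Qed.

Lemma has_derivX f n x a : has_deriv f x a ->
  has_deriv (fun y => f y ^+ n) x (n%:R * f x ^+ n.-1 * a).
Proof.
rewrite /has_deriv => df.
have -> : (fun y => f y ^+ n) = f ^+ n by apply/funext => y; rewrite fctE.
exact: is_deriveX.
Qed.

Lemma has_deriv_pow n x : has_deriv (fun y : R => y ^+ n) x (n%:R * x ^+ n.-1).
Proof.
by apply: has_deriv_eq; [apply: has_derivX; exact: has_deriv_id|rewrite mulr1].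
Qed.

Lemma has_deriv_comp f g x a b : has_deriv f (g x) a -> has_deriv g x b ->
  has_deriv (fun y => f (g y)) x (a * b).
Proof. by rewrite /has_deriv => df dg; exact: (is_derive1_comp (f := f)). Qed.

Lemma has_deriv_ln f x a : 0 < f x -> has_deriv f x a ->
  has_deriv (fun y => ln (f y)) x (a / f x).
Proof.
move=> fx0 df; apply: has_deriv_eq.
  by apply: has_deriv_comp df; exact: is_derive1_ln.
by rewrite mulrC.
Qed.

Lemma has_deriv_near f g x a : (\forall y \near x, f y = g y) ->
  has_deriv f x a -> has_deriv g x a.
Proof. by rewrite /has_deriv => fg df; apply: near_eq_is_derive df. Qed.

(** Unordered, so that mean values between [0] and [x] need no discussion of the sign of [x]. *)
Definition between x y c := (x <= c <= y) || (y <= c <= x).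

Lemma MVT_between f df x y :
  (forall c, between x y c -> has_deriv f c (df c)) ->
  exists2 c, between x y c & f y - f x = df c * (y - x).
Proof.
move=> fdf.
wlog xy : x y fdf / x <= y.
  move=> H; have [xy|/ltW yx] := leP x y; first exact: H.
  have [c|c cb E] := H y x _ yx; first by rewrite /between orbC; exact: fdf.
  exists c; first by rewrite /between orbC.
  by rewrite -opprB E -[in RHS]opprB mulrN.
have [||c cxy E] := @MVT_segment R f df x y xy.
- by move=> z; rewrite in_itv/= => /andP[xz zy]; apply: fdf; rewrite /between (ltW xz) (ltW zy).
- apply: derivable_within_continuous => z; rewrite in_itv /= => zxy.
  by have /fdf[] : between x y z by rewrite /between zxy.
- by exists c => //; move: cxy; rewrite in_itv /between /= => ->.
Qed.

Lemma between_norm x y c d : `|x| < d -> `|y| < d -> between x y c -> `|c| < d.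
Proof. by rewrite /between !ltr_norml => *; lra. Qed.

Lemma between_dist x y c : between x y c -> `|x - c| <= `|x - y|.
Proof.
move=> /orP[] /andP[h1 h2].
  by rewrite !ler0_norm; lra.
by rewrite !ger0_norm; lra.
Qed.

Lemma Rintegral_FTC f F a b : a < b ->
  (forall y, a <= y <= b -> has_deriv F y (f y)) ->
  (forall y, a <= y <= b -> {for y, continuous f}) ->
  \int[mu]_(y in `[a, b]) f y = F b - F a.
Proof.
move=> ab dF cf.
have cF y : a <= y <= b -> {for y, continuous F}.
  move=> /dF -[yF _]; apply: differentiable_continuous.
  exact/derivable1_diffP.
have H := @continuous_FTC2 R f F a b ab.
rewrite /Rintegral H //=.
- by apply: continuous_in_subspaceT => y; rewrite inE/= in_itv/= => /cf.
- split.
  + move=> y; rewrite in_itv/= => /andP[ay yb].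
    by have /dF[] : a <= y <= b by rewrite (ltW ay) (ltW yb).
  + by apply: cvg_at_right_filter; apply: cF; rewrite lexx ltW.
  + by apply: cvg_at_left_filter; apply: cF; rewrite lexx ltW.
- move=> y; rewrite in_itv/= => /andP[ay yb].
  rewrite derive1E; have := dF y; rewrite (ltW ay) (ltW yb) => /(_ isT) yF.
  exact: derive_val.
Qed.

Lemma Rintegral_FTC_oo f F a b : a < b ->
  (forall y, a <= y <= b -> has_deriv F y (f y)) ->
  (forall y, a <= y <= b -> {for y, continuous f}) ->
  \int[mu]_(y in `]a, b[) f y = F b - F a.
Proof.
move=> ab dF cf; rewrite -(Rintegral_FTC ab dF cf).
have iab : mu.-integrable `[a, b] (EFin \o f).
  apply: continuous_compact_integrable; first exact: segment_compact.
  by apply: continuous_in_subspaceT => y; rewrite inE/= in_itv/= => /cf.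
rewrite Rintegral_itv_bndo_bndc.
  rewrite Rintegral_itv_obnd_cbnd//.
  by apply: integrableS iab => //; exact: subset_itv_oc_cc.
by apply: integrableS iab => //; exact: subset_itv_oo_cc.
Qed.

Lemma lipschitz_deriv_le f x a C r : 0 < r -> has_deriv f x a ->
  (forall y, `|y - x| < r -> `|f y - f x| <= C * `|y - x|) -> `|a| <= C.
Proof.
move=> r0 [/cvg_ex[l fl] fa] lip.
have {}fa : l = a by rewrite -fa; apply/esym/cvg_lim.
subst l.
have nl : `|h^-1 *: ((f \o shift x) (h *: 1) - f x)| @[h --> 0^'] --> `|a|.
  exact: cvg_norm.
apply: (cvgr_to_le nl).
near=> h.
have h0 : h != 0 by near: h; exact: nbhs_dnbhs_neq.
rewrite /= scaler1 normrM normfV ler_pdivrMl ?normr_gt0// mulrC.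
rewrite -{2}[h](addrK x); apply: lip; rewrite addrK.
by near: h; exact: dnbhs0_lt.
Unshelve. all: end_near. Qed.

End Calculus.

(** * Integrability criteria *)

Section Integrability.
Context {R : realType}.
Notation mu := (@lebesgue_measure R).

Lemma integrable_oneDsqrV : mu.-integrable setT (EFin \o (fun y : R => (1 + y ^+ 2)^-1)).
Proof.
have mf : measurable_fun setT (fun y : R => (1 + y ^+ 2)^-1).
  by apply: measurable_inv_fun; apply: measurable_funD => //; exact: measurable_funX.
apply/integrableP; split; first exact/measurable_EFinP.
have pos (y : R) : 0 <= (1 + y ^+ 2)^-1 by rewrite invr_ge0 addr_ge0// sqr_ge0.
under eq_integral do rewrite /= ger0_norm//.
rewrite ge0_symfun_integralT//; first last.
- by move=> y /=; rewrite sqrrN.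
- exact: (@continuous_oneDsqrV R).
rewrite -set_itvcy.
have /= -> := @integral0y_oneDsqr R.
by rewrite -EFinM ltry.
Qed.

(** The dominating function is [A] on a bounded interval plus [B * |h|] outside. With [h y] of the
    form [w0 y / y] it reduces each moment and each kernel to one tail, whose integrability comes
    from [L^2]. *)
Lemma integrable_near_far (h f : R -> R) (d A B : R) : 0 <= A -> 0 <= B ->
  mu.-integrable setT (EFin \o (fun y => if `|y| < d then 0 else h y)) ->
  measurable_fun setT f ->
  (forall y, `|y| < d -> `|f y| <= A) ->
  (forall y, d <= `|y| -> `|f y| <= B * `|h y|) ->
  mu.-integrable setT (EFin \o f).
Proof.
move=> A0 B0 ih mf fA fB.
have i1 : mu.-integrable setT (EFin \o \1_`]- d, d[) by exact: integrable_indic_itv.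
have i2 := integrableD measurableT (integrableZl measurableT A i1)
  (integrableZl measurableT B (integrable_norm ih)).
apply: le_integrable i2 => //; first exact/measurable_EFinP.
move=> y _ /=; rewrite lee_fin indicE.
have -> : (y \in `]- d, d[%classic) = (`|y| < d).
  by rewrite ltr_norml; apply/idP/idP; rewrite inE /= in_itv.
have [yd|yd] := ltP `|y| d.
  by rewrite normr0 mulr0 addr0 mulr1 (le_trans (fA y yd))// ler_norm.
by rewrite mulr0 add0r (le_trans (fB y yd))// ler_norm.
Qed.

(** By [|f y / y| <= f y ^+ 2 + y ^- 2]; for [|y| >= d] the second term is at most [1 + d ^- 2]
    times [(1 + y ^+ 2)^-1], since [(1 + y ^+ 2) / y ^+ 2 = 1 + y ^- 2]. *)
Lemma Lfun2_div_integrable (f : R -> R) (d : R) : 0 < d ->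
  f \in Lfun mu 2%:E ->
  mu.-integrable setT (EFin \o (fun y => if `|y| < d then 0 else f y / y)).
Proof.
move=> d0 f2; have isq := Lfun2_integrable_sqr f2.
have mf : measurable_fun setT f.
  by move: f2; rewrite inE => /andP[]; rewrite inE.
have i2 := integrableD measurableT isq
  (integrableZl measurableT (1 + d ^- 2) integrable_oneDsqrV).
apply: le_integrable i2 => //.
  apply/measurable_EFinP; apply: measurable_fun_ifT => //.
    exact: measurable_norm_lt.
  by apply: measurable_funM => //; exact: measurable_inv_fun.
move=> y _ /=; rewrite lee_fin.
have pos : 0 <= (1 + d ^- 2) * (1 + y ^+ 2)^-1.
  by rewrite mulr_ge0 ?invr_ge0 ?addr_ge0 ?invr_ge0 ?sqr_ge0.
have sq0 := sqr_ge0 (f y).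
case: ltP => yd; first by rewrite normr0 normr_ge0.
have y0 : 0 < `|y| by exact: lt_le_trans yd.
rewrite [leRHS]ger0_norm ?addr_ge0//.
have y2 : 0 < y ^+ 2 by rewrite exprn_even_gt0// -normr_gt0.
have d2 : 0 < d ^+ 2 by exact: exprn_gt0.
have ysq : y ^- 2 <= (1 + d ^- 2) * (1 + y ^+ 2)^-1.
  rewrite ler_pdivlMr; last by rewrite addr_gt0.
  rewrite mulrDr mulr1 mulVf ?gt_eqF// addrC lerD2l lef_pV2 ?posrE//.
  by rewrite -(real_normK (num_real y)) lerXn2r// nnegrE ltW.
apply: le_trans (lerD (lexx _) ysq).
rewrite normrM normfV -(real_normK (num_real (f y))) -(real_normK (num_real y)) -exprVn.
have := sqr_ge0 (`|f y| - `|y|^-1); have := sqr_ge0 `|f y|; have := sqr_ge0 (`|y|^-1).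
rewrite sqrrB; lra.
Qed.

Lemma Rintegral_gt0 (f : R -> R) (a b c : R) : a < b -> 0 < c ->
  mu.-integrable setT (EFin \o f) -> (forall y, 0 <= f y) ->
  (forall y, a <= y <= b -> c <= f y) -> 0 < \int[mu]_y f y.
Proof.
move=> ab c0 intf f0 cf.
have : \int[mu]_(y in `[a, b]) cst c y <= \int[mu]_y f y.
  rewrite Rintegral_mkcond; apply: le_Rintegral => //.
    have := integrableZl measurableT c (integrable_indic_itv a b true false).
    apply: eq_integrable => // y _; rewrite /= patchE indicE.
    by rewrite -EFinM; case: (y \in _); rewrite ?mulr1 ?mulr0.
  move=> y _; rewrite patchE; case: ifPn => // yab; apply: cf.
  by move: yab; rewrite inE /= in_itv.
apply: lt_le_trans; rewrite Rintegral_cst//= lebesgue_measure_itv /= lte_fin ab /=.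
by rewrite mulr_gt0// subr_gt0.
Qed.

End Integrability.

(** * Regularity of principal values *)

Section PrincipalValue.
Context {R : realType}.
Notation mu := (@lebesgue_measure R).
Variables (k dk : R -> R) (d L : R).
Hypotheses (d0 : 0 < d) (mk : measurable_fun setT k).
Hypothesis ik : mu.-integrable setT
  (EFin \o (fun y => if `|y| < d then 0 else k y / y)).
Hypothesis dkk : forall x : R, `|x| < d -> has_deriv k x (dk x).
Hypothesis Ldk : forall x y : R, `|x| < d -> `|y| < d -> `|dk x - dk y| <= L * `|x - y|.

(* Subtracting [k x] on [|y| < d] regularizes the kernel, at the cost of the
   explicit principal value [pv_log x] of [1 / (x - y)] on [|y| < d]. The value at
   [y = x] makes the kernel Lipschitz in [x]. *)
Definition pv_kernel (x y : R) : R :=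
  if y == x then - dk x else (k y - (if `|y| < d then k x else 0)) / (x - y).

Let L0 : 0 <= L.
Proof.
have dp := d0.
have := @Ldk (d / 2) 0; rewrite normr0 subr0 gtr0_norm; last lra.
have d2 : d / 2 < d by lra.
move=> /(_ d2 d0) /(le_trans (normr_ge0 _)); by rewrite pmulr_lge0 ?divr_gt0.
Qed.

Let M : R := `|dk 0| + L * d.

Let dk_bound x : `|x| < d -> `|dk x| <= M.
Proof.
have dp := d0.
move=> xd; have := @Ldk x 0 xd; rewrite normr0 subr0 => /(_ d0) H.
have -> : dk x = dk 0 + (dk x - dk 0) by ring.
rewrite (le_trans (ler_normD _ _))// lerD2l (le_trans H)//.
by rewrite ler_wpM2l// ltW.
Qed.

Let mvt x y : `|x| < d -> `|y| < d ->
  exists2 c, between x y c & `|c| < d /\ k y - k x = dk c * (y - x).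
Proof.
have dp := d0.
move=> xd yd; have [|c cxy E] := @MVT_between R k dk x y.
  by move=> c /(between_norm xd yd) /dkk.
by exists c => //; split => //; exact: between_norm cxy.
Qed.

(** Up to sign, the kernel is the average of [dk] on the segment from [x] to [y], and averages over
    segments with the common end [y] inherit the Lipschitz constant of [dk]. Rather than
    integrating, the mean value theorem is applied in [s] to the difference [Phi] of the two
    parametrized quotients: it yields one [s] for both kernels, and the two arguments of [dk] differ
    by [(1 - s) * (x - x')]. *)
Let kern_lip_near x x' y : `|x| < d -> `|x'| < d -> `|y| < d ->
  `|pv_kernel x y - pv_kernel x' y| <= L * `|x - x'|.
Proof.
have dp := d0.
move=> xd xd' yd; rewrite /pv_kernel yd.
have aux u v : `|u| < d -> `|v| < d -> v != u ->
    `|- dk v - (k v - k u) / (u - v)| <= L * `|v - u|.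
  move=> ud vd vu; have [c cuv [cd ->]] := mvt ud vd.
  have -> : - dk v - dk c * (v - u) / (u - v) = - (dk v - dk c).
    by field; rewrite subr_eq0 eq_sym.
  rewrite normrN (le_trans (Ldk vd cd))// ler_wpM2l//.
  by apply: between_dist; move: cuv; rewrite /between orbC.
case: (eqVneq y x) => [<-|yx]; case: (eqVneq y x') => [<-|yx'].
- by rewrite !subrr normr0 mulr0.
- exact: aux.
- by rewrite distrC [`|x - y|]distrC; exact: aux.
pose Phi (s : R) := k (x + s * (y - x)) / (y - x) - k (x' + s * (y - x')) / (y - x').
pose dPhi (s : R) := dk (x + s * (y - x)) - dk (x' + s * (y - x')).
have yx0 : y - x != 0 by rewrite subr_eq0.
have yx0' : y - x' != 0 by rewrite subr_eq0.
have conv s u : between 0 1 s -> `|u| < d -> `|u + s * (y - u)| < d.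
  rewrite /between => /orP[|]/andP[s0 s1] ud; last by exfalso; lra.
  apply: (between_norm ud yd); rewrite /between.
  by have [uy|yu] := leP u y; apply/orP; [left|right]; apply/andP; split; nra.
have dlin u s : has_deriv (fun s : R => u + s * (y - u)) s (y - u).
  apply: has_deriv_eq.
    apply: has_derivD; first exact: has_deriv_cst.
    by apply: has_derivM; [exact: has_deriv_id|exact: has_deriv_cst].
  by rewrite mulr0 !add0r mulr1.
have dterm u s : y - u != 0 -> between 0 1 s -> `|u| < d ->
    has_deriv (fun s : R => k (u + s * (y - u)) / (y - u)) s (dk (u + s * (y - u))).
  move=> yu sb ud; apply: has_deriv_eq.
    apply: has_derivM; last exact: has_deriv_cst.
    apply: has_deriv_comp; last exact: dlin.
    exact/dkk/conv.
  by rewrite mulr0 add0r mulrC mulfK.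
have [|s sb] := @MVT_between R Phi dPhi 0 1.
  move=> s sb; rewrite /dPhi; apply: has_derivD; first exact: dterm.
  by apply: has_derivN; exact: dterm.
rewrite /Phi !mul1r !mul0r !addr0 subr0 mulr1 ![_ + (y - _)]addrC !subrK => E.
have -> : (k y - k x) / (x - y) - (k y - k x') / (x' - y) = - dPhi s.
  by rewrite -E; field; rewrite yx0 yx0' !subr_eq0 ![_ == y]eq_sym yx yx'.
rewrite normrN (le_trans (Ldk _ _))//; [exact: conv|exact: conv|].
have -> : x + s * (y - x) - (x' + s * (y - x')) = (1 - s) * (x - x') by ring.
have /andP[s0 s1] : 0 <= s <= 1 by move: sb; rewrite /between => /orP[//|] /andP[? ?]; exfalso; lra.
rewrite normrM ger0_norm; last lra.
by rewrite ler_wpM2l// ler_piMl//; lra.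
Qed.

(** Common shape of the dominating functions: constant where [k] is regular, comparable with the
    integrable tail elsewhere. *)
Definition pv_weight (c1 c2 y : R) : R := if `|y| < d then c1 else c2 * `|k y / y|.

Let mweight c1 c2 : measurable_fun setT (pv_weight c1 c2).
Proof.
apply: measurable_fun_ifT => //; first exact: measurable_norm_lt.
apply: measurable_funM => //; apply: measurableT_comp => //.
by apply: measurable_funM => //; exact: measurable_inv_fun.
Qed.

Let int_weight c1 c2 : 0 <= c1 -> 0 <= c2 ->
  mu.-integrable setT (EFin \o pv_weight c1 c2).
Proof.
move=> c10 c20.
apply: (@integrable_near_far R (fun y => k y / y) _ d c1 c2) => // y yd.
  by rewrite /pv_weight yd ger0_norm.
by rewrite /pv_weight ltNge yd /= normrM normr_id ger0_norm.
Qed.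

(** The reason for restricting [x] to [|x| < d / 2]: for all far [y], the kernel [1 / (x - y)] stays
    comparable with [1 / y]. *)
Let far_sub (x y : R) : `|x| < d / 2 -> ~~ (`|y| < d) -> `|y| / 2 <= `|x - y|.
Proof.
have dp := d0.
rewrite -leNgt => xd yd; have := lerB_dist y x; rewrite distrC; lra.
Qed.

Let kern_bound (x y : R) : `|x| < d / 2 -> `|pv_kernel x y| <= pv_weight M 2 y.
Proof.
have dp := d0.
move=> xd; have xd' : `|x| < d by lra.
rewrite /pv_kernel /pv_weight; case: (eqVneq y x) => [->|yx].
  by rewrite xd' normrN; exact: dk_bound.
have xy0 : x - y != 0 by rewrite subr_eq0 eq_sym.
have [yd|yd] := boolP (`|y| < d).
  have [c _ [cd ->]] := mvt xd' yd.
  have -> : dk c * (y - x) / (x - y) = - dk c by field.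
  by rewrite normrN; exact: dk_bound.
have := far_sub xd yd; rewrite -leNgt in yd => H.
have y0 : 0 < `|y| by lra.
rewrite subr0 !normrM !normfV mulrCA ler_wpM2l//.
rewrite -[2]invrK -invfM lef_pV2 ?posrE ?normr_gt0//; last lra.
by rewrite mulrC.
Qed.

Let kern_lip (x x' y : R) : `|x| < d / 2 -> `|x'| < d / 2 ->
  `|pv_kernel x y - pv_kernel x' y| <= pv_weight L (4 / d) y * `|x - x'|.
Proof.
have dp := d0.
move=> xd xd'; rewrite /pv_weight; case: ifPn => yd.
  by apply: kern_lip_near => //; lra.
have H := far_sub xd yd; have H' := far_sub xd' yd.
have dy := yd; rewrite -leNgt in dy.
have y0 : 0 < `|y| by lra.
have yx : x - y != 0 by rewrite -normr_gt0; lra.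
have yx' : x' - y != 0 by rewrite -normr_gt0; lra.
have yy0 : y != 0 by rewrite -normr_gt0.
rewrite /pv_kernel (negbTE yd) ifN; last by rewrite -subr_eq0 -oppr_eq0 opprB.
rewrite ifN; last by rewrite -subr_eq0 -oppr_eq0 opprB.
rewrite !subr0.
have -> : k y / (x - y) - k y / (x' - y) =
    (k y / y) * (x - x') * - (y / ((x - y) * (x' - y))).
  by field; rewrite yx yx' yy0.
(* Both factors of the denominator are at least [|y| / 2], so the quotient is at most [4 / |y|],
   hence at most [4 / d]. *)
have zb : `|y / ((x - y) * (x' - y))| <= 4 / d.
  rewrite normrM normfV normrM ler_pdivrMr; last by rewrite mulr_gt0//; lra.
  rewrite mulrAC ler_pdivlMr//.
  have : `|y| / 2 * (`|y| / 2) <= `|x - y| * `|x' - y|.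
    by apply: ler_pM => //; lra.
  nra.
rewrite normrM normrN normrM.
have -> : 4 / d * `|k y / y| * `|x - x'| = (`|k y / y| * `|x - x'|) * (4 / d) by ring.
by rewrite ler_wpM2l// mulr_ge0.
Qed.

Let mkern (x : R) : measurable_fun setT (pv_kernel x).
Proof.
apply: measurable_fun_ifT => //; first exact: measurable_fun_eqr.
apply: measurable_funM; last by apply: measurable_inv_fun; exact: measurable_funB.
apply: measurable_funB => //; apply: measurable_fun_ifT => //.
exact: measurable_norm_lt.
Qed.

Let M0 : 0 <= M.
Proof. by rewrite addr_ge0// mulr_ge0// ltW. Qed.

Let int_kern (x : R) : `|x| < d / 2 -> mu.-integrable setT (EFin \o pv_kernel x).
Proof.
move=> xd; have i := int_weight M0 (ler0n R 2).
apply: le_integrable i => //; first by apply/measurable_EFinP; exact: mkern.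
move=> y _ /=; rewrite lee_fin (le_trans (kern_bound _ _))// ler_norm//.
Qed.

Definition pv_reg (x : R) : R := \int[mu]_y pv_kernel x y.

Let kern_derivable a y : `|a| < d / 2 -> y <> a -> derivable (pv_kernel^~ y) a 1.
Proof.
have dp := d0.
move=> ad ya; have ad' : `|a| < d by lra.
suff [l] : exists l, has_deriv (pv_kernel^~ y) a l by case.
eexists; apply: (has_deriv_near (f := fun x => (k y - (if `|y| < d then k x else 0)) / (x - y))).
  near=> x; rewrite /pv_kernel [RHS]ifN//.
  near: x; exists `|a - y|.
    by rewrite /= normr_gt0 subr_eq0; apply/eqP => ay; apply: ya.
  by move=> z /= az; apply/eqP => yz; rewrite yz ltxx in az.
apply: has_derivM; last first.
  apply: has_derivV; first by rewrite subr_eq0; apply/eqP => ay; apply: ya.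
  by apply: has_derivD; [exact: has_deriv_id|exact: has_deriv_cst].
apply: has_derivD; first exact: has_deriv_cst.
apply: has_derivN; instantiate (1 := if `|y| < d then dk a else 0).
by case: (`|y| < d); [exact: dkk|exact: has_deriv_cst].
Unshelve. all: end_near. Qed.

Lemma pv_reg_derivable a : `|a| < d / 2 -> derivable pv_reg a 1.
Proof.
move=> ad; have iG := int_weight L0 (ltW (divr_gt0 (ltr0n R 4) d0)).
have near_a x : `|x - a| < d / 2 - `|a| -> `|x| < d / 2.
  by have := ler_normD (x - a) a; rewrite subrK; lra.
apply: (derivable_under_lipschitz (G := pv_weight L (4 / d)) (r := d / 2 - `|a|)).
- by rewrite subr_gt0.
- by move=> x /near_a; exact: int_kern.
- exact: iG.
- by move=> x y /near_a xd; exact: kern_lip.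
- by move=> y; exact: kern_derivable.
Qed.

Lemma pv_reg_lip x x' : `|x| < d / 2 -> `|x'| < d / 2 ->
  `|pv_reg x - pv_reg x'| <= \int[mu]_y pv_weight L (4 / d) y * `|x - x'|.
Proof.
move=> xd xd'; have iG := int_weight L0 (ltW (divr_gt0 (ltr0n R 4) d0)).
have iB : mu.-integrable setT (EFin \o (fun y => pv_kernel x y - pv_kernel x' y)).
  exact: (integrableB measurableT (int_kern xd) (int_kern xd')).
rewrite /pv_reg -RintegralB//; [|exact: int_kern|exact: int_kern].
rewrite (le_trans (le_normr_Rintegral _ iB))// -RintegralZr//.
apply: le_Rintegral => //.
- exact: (integrable_norm iB).
- exact: (integrableZr measurableT `|x - x'| iG).
- by move=> y _; exact: kern_lip.
Qed.

Let ind (y : R) : R := if `|y| < d then 1 else 0.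

Let mind x : measurable_fun setT (fun y => ind y / (x - y)).
Proof.
apply: measurable_funM.
  by apply: measurable_fun_ifT => //; exact: measurable_norm_lt.
by apply: measurable_inv_fun; exact: measurable_funB.
Qed.

Let int_ind (x e : R) : 0 < e -> mu.-integrable (trunc x e) (EFin \o (fun y => ind y / (x - y))).
Proof.
move=> e0; have i := int_weight (ltW (divr_gt0 ltr01 e0)) (lexx 0).
have it : mu.-integrable (trunc x e) (EFin \o pv_weight (1 / e) 0).
  by apply: integrableS i => //; exact: measurable_trunc.
apply: le_integrable it => //.
- exact: measurable_trunc.
- by apply/measurable_EFinP; apply: measurable_funTS; exact: mind.
- move=> y; rewrite /trunc /= => exy; rewrite lee_fin /pv_weight /ind.
  case: (`|y| < d); last by rewrite !mul0r.
  have xy0 : 0 < `|x - y| by exact: lt_trans exy.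
  by rewrite !div1r !normfV lef_pV2 ?posrE ?(gtr0_norm e0) ?ltW.
Qed.

Definition pv_log (x : R) : R := ln (d + x) - ln (d - x).

(** The two intervals left by the truncation contribute [ln e] with opposite signs, so the value
    does not depend on [e]. *)
Let trunc_log (x e : R) : `|x| < d / 2 -> 0 < e -> e < d / 2 ->
  \int[mu]_(y in trunc x e) (ind y / (x - y)) = pv_log x.
Proof.
have dp := d0; move=> xd e0 ed.
have [x1 x2] : - (d / 2) < x /\ x < d / 2 by move: xd; rewrite ltr_norml => /andP[].
pose A := `]- d, x - e[%classic; pose B := `]x + e, d[%classic.
pose g (y : R) := (x - y)^-1.
have AB : trunc x e `&` `]- d, d[ = A `|` B.
  rewrite truncE /A /B; apply/seteqP; split => y /=; rewrite !in_itv/=.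
    move=> [/negP]; rewrite negb_and -!ltNge => /orP[h|h] /andP[h1 h2].
      by left; rewrite h1 h.
    by right; rewrite h h2.
  by case=> /andP[h1 h2]; (split; [apply/negP; rewrite negb_and -!ltNge|]);
    [apply/orP; left | | apply/orP; right |]; lra.
have -> : \int[mu]_(y in trunc x e) (ind y / (x - y)) = \int[mu]_(y in A `|` B) g y.
  rewrite -AB Rintegral_mkcondr; apply: eq_Rintegral => y _.
  rewrite patchE /ind ltr_norml; case: ifPn => yd.
    by rewrite mem_set ?div1r.
  by rewrite memNset ?mul0r//=; apply/negP.
have iAB : mu.-integrable (A `|` B) (EFin \o g).
  have iT : mu.-integrable (trunc x e `&` `]- d, d[) (EFin \o (fun y => ind y / (x - y))).
    apply: integrableS (int_ind x e0); [exact: measurable_trunc| |exact: subIsetl].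
    by apply: measurableI => //; exact: measurable_trunc.
  rewrite -AB; apply: eq_integrable iT.
    by apply: measurableI => //; exact: measurable_trunc.
  move=> y /=; rewrite inE => -[_ /=]; rewrite in_itv/= -ltr_norml /ind => ->.
  by rewrite div1r.
have mA : measurable A by exact: measurable_itv.
have mB : measurable B by exact: measurable_itv.
have iA : mu.-integrable A (EFin \o g).
  by apply: integrableS iAB => //; exact: measurableU.
have iB : mu.-integrable B (EFin \o g).
  by apply: integrableS iAB => //; exact: measurableU.
rewrite Rintegral_setU//; last first.
  rewrite /A /B; apply/disj_setPS => y [/=].
  rewrite !in_itv/= => /andP[? ?] /andP[? ?]; lra.
have cg y : y != x -> {for y, continuous g}.
  move=> yx; apply: cvgV; first by rewrite subr_eq0 eq_sym.
  by apply: cvgB; [exact: cvg_cst|exact: cvg_id].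
rewrite (Rintegral_FTC_oo (F := fun y => - ln (x - y))); first last.
- by move=> y /andP[? ?]; apply: cg; apply/eqP; lra.
- move=> y /andP[? ?]; have xy0 : 0 < x - y by lra.
  apply: has_deriv_eq.
    apply: has_derivN; apply: (has_deriv_ln (f := fun y => x - y) xy0).
    by apply: has_derivD; [exact: has_deriv_cst|apply: has_derivN; exact: has_deriv_id].
  by rewrite /g add0r mulN1r opprK.
- by lra.
rewrite (Rintegral_FTC_oo (F := fun y => - ln (y - x))); first last.
- by move=> y /andP[? ?]; apply: cg; apply/eqP; lra.
- move=> y /andP[? ?]; have xy0 : 0 < y - x by lra.
  apply: has_deriv_eq.
    apply: has_derivN; apply: (has_deriv_ln (f := fun y => y - x) xy0).
    by apply: has_derivD; [exact: has_deriv_id|exact: has_deriv_cst].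
  by rewrite /g addr0 div1r -[x - y]opprB invrN.
- by lra.
have -> : x - (x - e) = e by ring.
have -> : x + e - x = e by ring.
have -> : x - - d = d + x by ring.
by rewrite /pv_log; ring.
Qed.

Definition pv (x : R) : R := pv_reg x + k x * pv_log x.

Lemma cvg_pv (x : R) : `|x| < d / 2 ->
  \int[mu]_(y in trunc x e) (k y / (x - y)) @[e --> 0^'+] --> pv x.
Proof.
move=> xd.
have : \int[mu]_(y in trunc x e) (pv_kernel x y) + k x * pv_log x @[e --> 0^'+] --> pv x.
  by apply: cvgD; [apply: cvg_trunc; exact: int_kern|exact: cvg_cst].
apply: cvg_trans; apply: near_eq_cvg; near=> e.
have e0 : 0 < e by [].
have ed : e < d / 2 by near: e; apply: nbhs_right_lt; rewrite divr_gt0.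
rewrite -(trunc_log xd e0 ed) -RintegralZl//; [|exact: measurable_trunc|exact: int_ind].
rewrite -RintegralD; first last.
- have := int_ind x e0.
  move=> /(integrableZl _ (k x)); apply; exact: measurable_trunc.
- apply: integrableS (int_kern xd) => //; exact: measurable_trunc.
- exact: measurable_trunc.
apply: eq_Rintegral => y; rewrite inE /trunc /= => exy.
have xy : y != x.
  by apply/eqP => yx; move: exy; rewrite yx subrr normr0 ltNge (ltW e0).
rewrite /pv_kernel (negbTE xy) /ind; case: (`|y| < d).
  by rewrite mulrA mulr1 -mulrDl subrK.
by rewrite !mul0r mulr0 subr0 addr0.
Unshelve. all: end_near. Qed.

(** At [x = 0] the logarithms cancel and the kernel is odd in [y]; [dk 0 = 0] makes this true of its
    diagonal value as well. *)
Lemma pv0 : (forall y, k (- y) = k y) -> dk 0 = 0 -> pv 0 = 0.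
Proof.
have dp := d0; move=> kN dk0.
rewrite /pv /pv_log addr0 subr0 subrr mulr0 addr0 /pv_reg.
apply: Rintegral_odd => //; first by apply: int_kern; rewrite normr0; lra.
move=> y; rewrite /pv_kernel kN normrN oppr_eq0 dk0 !sub0r opprK.
by case: ifP => _; rewrite ?oppr0// invrN mulrN opprK.
Qed.

Let dlog (x : R) := (d + x)^-1 + (d - x)^-1.

Let pv_log_deriv (x : R) : `|x| < d / 2 -> has_deriv pv_log x (dlog x).
Proof.
have dp := d0; rewrite ltr_norml => /andP[x1 x2].
apply: has_deriv_eq.
  apply: has_derivD; last apply: has_derivN; (apply: has_deriv_ln; [|apply: has_derivD; [exact: has_deriv_cst|]]).
  - by lra.
  - exact: has_deriv_id.
  - by lra.
  - by apply: has_derivN; exact: has_deriv_id.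
by rewrite !add0r mulN1r opprK mul1r.
Qed.

Lemma pv_deriv : exists2 C : R, 0 <= C & forall x, `|x| < d / 2 ->
  exists2 l, has_deriv pv x l & `|l| <= C.
Proof.
have dp := d0.
pose I := \int[mu]_y pv_weight L (4 / d) y.
pose Mk := `|k 0| + M * d.
(* For [|x| < d / 2], both [d + x] and [d - x] lie between [d / 2] and [3 * d / 2]. *)
pose Ml := ln (3 * d / 2) - ln (d / 2).
have kb x : `|x| < d / 2 -> `|k x| <= Mk.
  move=> xd; have [||c _ [cd E]] := @mvt 0 x; rewrite ?normr0; [lra|lra|].
  have -> : k x = k 0 + dk c * (x - 0) by rewrite -E; ring.
  rewrite subr0 (le_trans (ler_normD _ _))// lerD2l normrM.
  by apply: ler_pM => //; [exact: dk_bound|lra].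
have lb x : `|x| < d / 2 -> `|pv_log x| <= Ml.
  rewrite ltr_norml => /andP[x1 x2].
  have l1 : ln (d + x) <= ln (3 * d / 2) by rewrite ler_ln ?posrE; lra.
  have l2 : ln (d - x) <= ln (3 * d / 2) by rewrite ler_ln ?posrE; lra.
  have l3 : ln (d / 2) <= ln (d + x) by rewrite ler_ln ?posrE; lra.
  have l4 : ln (d / 2) <= ln (d - x) by rewrite ler_ln ?posrE; lra.
  by rewrite ler_norml /pv_log /Ml; lra.
have db x : `|x| < d / 2 -> `|dlog x| <= 4 / d.
  rewrite ltr_norml => /andP[x1 x2].
  have inv2 u : d / 2 < u -> 0 < u^-1 /\ u^-1 <= 2 / d.
    move=> du; rewrite invr_gt0; split; first lra.
    by rewrite -invf_div lef_pV2 ?posrE; lra.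
  have [a1 a2] : 0 < (d + x)^-1 /\ (d + x)^-1 <= 2 / d by apply: inv2; lra.
  have [b1 b2] : 0 < (d - x)^-1 /\ (d - x)^-1 <= 2 / d by apply: inv2; lra.
  have -> : 4 / d = 2 / d + 2 / d by field; rewrite gt_eqF.
  by rewrite /dlog ger0_norm; lra.
exists (`|I| + (Mk * (4 / d) + Ml * M)).
  have Ml0 : 0 <= Ml by rewrite (le_trans (normr_ge0 _) (lb 0 _))// normr0; lra.
  have Mk0 : 0 <= Mk by rewrite addr_ge0// mulr_ge0// ltW.
  have d4 : 0 <= 4 / d by rewrite divr_ge0// ltW.
  by rewrite addr_ge0// addr_ge0// mulr_ge0.
move=> x xd.
have xd' : `|x| < d by lra.
have hreg : has_deriv pv_reg x (derive1 pv_reg x).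
  by rewrite /has_deriv derive1E; apply: derivableP; exact: pv_reg_derivable.
exists (derive1 pv_reg x + (k x * dlog x + pv_log x * dk x)).
  apply: has_derivD hreg _; apply: has_derivM; first exact: dkk.
  exact: pv_log_deriv.
rewrite (le_trans (ler_normD _ _))// lerD//; last first.
  rewrite (le_trans (ler_normD _ _))// !normrM lerD// ler_pM//.
  - exact: kb. - exact: db. - exact: lb. - exact: dk_bound.
(* The derivative of [pv_reg] is bounded through its Lipschitz constant, the integral of the weight,
   without a formula for it. *)
apply: (lipschitz_deriv_le (r := d / 2 - `|x|) _ hreg); first by rewrite subr_gt0.
move=> y yx.
have yd : `|y| < d / 2 by have := ler_normD (y - x) x; rewrite subrK; lra.
rewrite (le_trans (pv_reg_lip yd xd))//.
have iG := int_weight L0 (ltW (divr_gt0 (ltr0n R 4) d0)).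
by rewrite ler_wpM2r// ler_norm.
Qed.

End PrincipalValue.

(** * Division by a power at a flat zero *)

Section Flatness.
Context {R : realType}.
Implicit Types (f : R -> R) (x y a d C : R).

Lemma has_deriv_derive1 f x a : has_deriv f x a -> derive1 f x = a.
Proof. by move=> df; rewrite derive1E; exact: derive_val. Qed.

Lemma derivable_has_deriv f x : derivable f x 1 -> has_deriv f x (derive1 f x).
Proof. by move=> df; rewrite /has_deriv derive1E; exact: derivableP. Qed.

Lemma has_deriv_unique f x a b : has_deriv f x a -> has_deriv f x b -> a = b.
Proof. by move=> /has_deriv_derive1 <- /has_deriv_derive1 <-. Qed.

(** A Taylor estimate without factorials: descending from order [N], each mean value step starting
    at [0] gains one factor [|x|]. A sequence linked by [has_deriv] replaces iterated derivatives so
    that the explicit formulas of [leading_rest] fit. *)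
Lemma flat_bound (F : nat -> R -> R) (N : nat) d C : 0 <= C ->
  (forall j x, (j < N)%N -> `|x| < d -> has_deriv (F j) x (F j.+1 x)) ->
  (forall j, (j < N)%N -> F j 0 = 0) ->
  (forall x, `|x| < d -> `|F N x| <= C) ->
  forall i x, (i <= N)%N -> `|x| < d -> `|F (N - i)%N x| <= C * `|x| ^+ i.
Proof.
move=> C0 dF F0 FN; elim=> [|i IH] x iN xd; first by rewrite subn0 expr0 mulr1 FN.
have d0 : `|0 : R| < d by rewrite normr0 (le_lt_trans _ xd).
have Ni : (N - i = (N - i.+1).+1)%N by lia.
have [c cb E] := @MVT_between R (F (N - i.+1)%N) (F (N - i)%N) 0 x
  (fun c cb => ltac:(rewrite Ni; apply: dF; [lia|exact: between_norm d0 xd cb])).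
have cd := between_norm d0 xd cb.
move: E; rewrite F0 ?subr0; last by lia.
move=> ->; rewrite normrM exprSr mulrA ler_wpM2r//.
rewrite (le_trans (IH c (ltnW iN) cd))// ler_wpM2l// lerXn2r ?nnegrE//.
by have := between_dist cb; rewrite !sub0r !normrN.
Qed.

Lemma has_deriv_flat f x d C : 0 < d ->
  (forall y, `|y - x| < d -> `|f y - f x| <= C * `|y - x| ^+ 2) -> has_deriv f x 0.
Proof.
move=> d0 H.
have fl : h^-1 *: ((f \o shift x) (h *: 1) - f x) @[h --> 0^'] --> (0 : R).
  apply/cvgr0Pnorm_lt => e e0.
  pose C1 := `|C| + 1.
  have C10 : 0 < C1 by rewrite ltr_wpDl.
  near=> h.
  have h0 : h != 0 by near: h; exact: nbhs_dnbhs_neq.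
  have hd : `|h| < d by near: h; exact: dnbhs0_lt.
  have he : `|h| < e / C1 by near: h; apply: dnbhs0_lt; rewrite divr_gt0.
  rewrite /= scaler1 normrM normfV ltr_pdivrMl ?normr_gt0//.
  have := H (h + x); rewrite addrK => /(_ hd) /le_lt_trans; apply.
  rewrite expr2 mulrCA ltr_pM2l ?normr_gt0//.
  rewrite ltr_pdivlMr// mulrC in he; apply: le_lt_trans he.
  by rewrite ler_wpM2r// /C1; have := ler_norm C; lra.
split; first by apply/cvg_ex; exists 0.
by apply/cvg_lim.
Unshelve. all: end_near. Qed.

Section Quotient.
Variables (F0 F1 F2 : R -> R) (m : nat) (C d : R).
Hypotheses (C0 : 0 <= C) (d0 : 0 < d).
Hypothesis F0b : forall y, `|y| < d -> `|F0 y| <= C * `|y| ^+ m.+2.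
Hypothesis F1b : forall y, `|y| < d -> `|F1 y| <= C * `|y| ^+ m.+1.
Hypothesis F2b : forall y, `|y| < d -> `|F2 y| <= C * `|y| ^+ m.
Hypothesis dF0 : forall y, `|y| < d -> has_deriv F0 y (F1 y).
Hypothesis dF1 : forall y, `|y| < d -> has_deriv F1 y (F2 y).

(* [F0 0 = F1 0 = 0] makes the junk value of both quotients at [0] the right one. *)
Definition quot (y : R) : R := F0 y / y ^+ m.
Definition dquot (y : R) : R := F1 y / y ^+ m - m%:R * (F0 y / y ^+ m.+1).
Let ddquot (y : R) : R := F2 y / y ^+ m - m%:R * (F1 y / y ^+ m.+1)
  - m%:R * (F1 y / y ^+ m.+1 - m.+1%:R * (F0 y / y ^+ m.+2)).

Let norm_quot (F : R -> R) i j y : `|F y| <= C * `|y| ^+ (i + j) ->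
  `|F y / y ^+ j| <= C * `|y| ^+ i.
Proof.
have [->|y0] := eqVneq y 0.
  case: j => [|j]; first by rewrite addn0 expr0 invr1 mulr1.
  by move=> _; rewrite expr0n /= invr0 mulr0 normr0 mulr_ge0// exprn_ge0.
move=> H; rewrite normrM normfV normrX ler_pdivrMr ?exprn_gt0 ?normr_gt0//.
by rewrite -mulrA -exprD.
Qed.

Let has_deriv_quot (F : R -> R) j y a : y != 0 -> has_deriv F y a ->
  has_deriv (fun y => F y / y ^+ j) y (a / y ^+ j - j%:R * (F y / y ^+ j.+1)).
Proof.
move=> y0 dF; apply: has_deriv_eq.
  apply: (has_derivM dF); apply: has_derivV; last exact: has_deriv_pow.
  by rewrite expf_neq0.
case: j => [|j]; first by rewrite !mul0r oppr0 mul0r mulr0 add0r addr0 mulrC.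
have p0 : y ^+ j != 0 by rewrite expf_neq0.
by rewrite /= !(exprS y); move: (y ^+ j) p0 => p p0; field; rewrite p0 y0.
Qed.

Lemma quot_bound y : `|y| < d -> `|quot y| <= C * `|y| ^+ 2.
Proof. by move=> yd; apply: norm_quot; exact: F0b. Qed.

Lemma dquot_bound y : `|y| < d -> `|dquot y| <= C * m.+1%:R * `|y|.
Proof.
move=> yd; have b0 : `|F0 y / y ^+ m.+1| <= C * `|y| ^+ 1.
  by apply: norm_quot; exact: F0b.
have b1 : `|F1 y / y ^+ m| <= C * `|y| ^+ 1 by apply: norm_quot; exact: F1b.
rewrite /dquot (le_trans (ler_normB _ _))// [`|m%:R * _|]normrM normr_nat -natr1.
have -> : C * (m%:R + 1) * `|y| = C * `|y| ^+ 1 + m%:R * (C * `|y| ^+ 1) by ring.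
by rewrite lerD// ler_wpM2l.
Qed.

Let ddquot_bound y : `|y| < d -> `|ddquot y| <= C * (1 + m%:R + m%:R * (1 + m.+1%:R)).
Proof.
move=> yd; have b0 : `|F0 y / y ^+ m.+2| <= C * `|y| ^+ 0.
  by apply: norm_quot; exact: F0b.
have b1 : `|F1 y / y ^+ m.+1| <= C * `|y| ^+ 0 by apply: norm_quot; exact: F1b.
have b2 : `|F2 y / y ^+ m| <= C * `|y| ^+ 0 by apply: norm_quot; exact: F2b.
rewrite !mulr1 in b0 b1 b2.
rewrite /ddquot (le_trans (ler_normB _ _))//.
have -> : C * (1 + m%:R + m%:R * (1 + m.+1%:R)) =
  (C + m%:R * C) + m%:R * (C + m.+1%:R * C) by ring.
rewrite lerD//.
  by rewrite (le_trans (ler_normB _ _))// lerD// [`|m%:R * _|]normrM normr_nat ler_wpM2l.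
rewrite [`|m%:R * _|]normrM normr_nat ler_wpM2l// (le_trans (ler_normB _ _))// lerD//.
by rewrite [`|m.+1%:R * _|]normrM normr_nat ler_wpM2l.
Qed.

Lemma quot_deriv y : `|y| < d -> has_deriv quot y (dquot y).
Proof.
move=> yd; have [->|y0] := eqVneq y 0.
  have z0 : `|0 : R| < d by rewrite normr0.
  have -> : dquot 0 = 0.
    by apply/eqP; rewrite -normr_le0 (le_trans (dquot_bound z0))// normr0 mulr0.
  apply: (has_deriv_flat (C := C) d0) => z; rewrite subr0 => zd.
  have -> : quot 0 = 0.
    apply/eqP; rewrite -normr_le0 (le_trans (quot_bound z0))// normr0.
    by rewrite expr0n mulr0.
  by rewrite subr0; exact: quot_bound.
exact/has_deriv_quot/dF0.
Qed.

(** The derivative [ddquot] of [dquot] is available off [0] only. If [x] and [y] are not on the same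
    side of [0], then [|x - y| = |x| + |y|] and the linear bound on [dquot] is enough; otherwise the
    segment avoids [0] and the mean value theorem applies. *)
Lemma dquot_lip : exists L : R, forall x y, `|x| < d -> `|y| < d ->
  `|dquot x - dquot y| <= L * `|x - y|.
Proof.
pose L1 := C * m.+1%:R; pose L2 := C * (1 + m%:R + m%:R * (1 + m.+1%:R)).
have L10 : 0 <= L1 by rewrite mulr_ge0.
have L20 : 0 <= L2.
  by rewrite (le_trans (normr_ge0 _) (ddquot_bound (y := 0) _))// normr0.
exists (L1 + L2) => x y xd yd.
have [xy0|xy0] := leP (x * y) 0.
  rewrite (le_trans (ler_normB _ _))//.
  have -> : `|x - y| = `|x| + `|y|.
    apply/eqP; rewrite -(eqrXn2 (n := 2))// ?addr_ge0// real_normK ?num_real//.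
    rewrite sqrrB sqrrD !real_normK ?num_real// -normrM ler0_norm//.
    by apply/eqP; ring.
  rewrite (le_trans (lerD (dquot_bound xd) (dquot_bound yd)))// -mulrDr.
  by rewrite ler_wpM2r ?addr_ge0// lerDl.
have nz c : between x y c -> c != 0.
  move=> cb; apply/eqP => c0; move: cb; rewrite /between c0 => /orP[] /andP[? ?]; nra.
have [|c cb E] := @MVT_between R dquot ddquot x y.
  move=> c cb; have c0 := nz c cb; have cd := between_norm xd yd cb.
  apply: has_derivD; first exact/has_deriv_quot/dF1.
  apply: has_derivN; apply: has_deriv_eq.
    apply: has_derivM; first exact: has_deriv_cst.
    exact/has_deriv_quot/dF0.
  by rewrite mulr0 addr0.
rewrite distrC E normrM [`|y - x|]distrC ler_wpM2r// (le_trans (ddquot_bound _))//.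
  exact: between_norm cb.
by rewrite lerDr.
Qed.
End Quotient.

Lemma odd_derive1n (f : R -> R) (k : nat) (delta : R) :
  (forall x, f (- x) = - f x) ->
  (forall j x, (j < k)%N -> `|x| < delta -> derivable (derive1n j f) x 1) ->
  forall j x, (j <= k)%N -> `|x| < delta ->
  derive1n j f (- x) = (-1) ^+ j.+1 * derive1n j f x.
Proof.
move=> fN df; elim=> [|j IH] x jk xd; first by rewrite /= fN expr1 mulN1r.
have d1 := derivable_has_deriv (df j x jk xd).
have d2 : has_deriv (derive1n j f) (- x) (derive1n j.+1 f (- x)).
  by apply/derivable_has_deriv/df => //; rewrite normrN.
have d3 : has_deriv (fun y => derive1n j f (- y)) x (derive1n j.+1 f (- x) * -1).
  apply: (has_deriv_comp (f := derive1n j f)) => //.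
  exact/has_derivN/has_deriv_id.
have d4 : has_deriv (fun y => derive1n j f (- y)) x ((-1) ^+ j.+1 * derive1n j.+1 f x).
  apply: (has_deriv_near (f := fun y => (-1) ^+ j.+1 * derive1n j f y)).
    near=> y; rewrite IH// ?(ltnW jk)//.
    near: y; exact: (cvgr_lt _ (cvg_norm cvg_id)).
  apply: has_deriv_eq; first by apply: has_derivM d1; exact: has_deriv_cst.
  by rewrite mulr0 addr0.
rewrite [in RHS]exprS mulN1r mulNr -(has_deriv_unique d3 d4); ring.
Unshelve. all: end_near. Qed.

End Flatness.

(** * Expansion of the Hilbert transform at the origin *)

Section Expansion.
Context {R : realType}.
Notation mu := (@lebesgue_measure R).
Variables (w0 : R -> R) (n : nat) (delta : R).
Hypotheses (w0_cont : continuous w0) (w0_L2 : w0 \in Lfun mu 2%:E).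
Hypothesis w0_odd : forall x, w0 (- x) = - w0 x.
Hypothesis w0_neg : forall x, 0 < x -> w0 x < 0.
Hypotheses (n_ge1 : (1 <= n)%N) (delta_gt0 : 0 < delta).
Hypothesis w0_Ck : Ck_on (2 * n + 3) `]- delta, delta[ w0.
Hypothesis w0_flat : forall k : nat, (k <= 2 * n)%N -> derive1n k w0 0 = 0.

Notation m := (2 * n + 1)%N.
Let kap : R := derive1n m w0 0 / m`!%:R.

(** The derivative of order [j] of [w0 - kap y^m], in a form valid for every [j]: the falling
    factorial [m ^_ j] vanishes for [j > m]. *)
Definition leading_rest (j : nat) (y : R) : R :=
  derive1n j w0 y - kap * (m ^_ j)%:R * y ^+ (m - j).

Let w0_der j (x : R) : (j < 2 * n + 3)%N -> `|x| < delta ->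
  has_deriv (derive1n j w0) x (derive1n j.+1 w0 x).
Proof.
move=> jn xd; apply: derivable_has_deriv; apply: w0_Ck.1 => //.
by rewrite /= in_itv /= -ltr_norml.
Qed.

Lemma rest_deriv j (x : R) : (j < 2 * n + 3)%N -> `|x| < delta ->
  has_deriv (leading_rest j) x (leading_rest j.+1 x).
Proof.
move=> jn xd; apply: has_derivD; first exact: w0_der.
apply: has_derivN; apply: has_deriv_eq.
  by apply: has_derivM; [exact: has_deriv_cst|exact: has_deriv_pow].
by rewrite mulr0 addr0 ffactnSr natrM subnS; ring.
Qed.

Lemma rest0 j : (j < 2 * n + 3)%N -> leading_rest j 0 = 0.
Proof.
move=> jn; rewrite /leading_rest; have [jm|mj] := ltnP j m.
  by rewrite w0_flat ?sub0r ?expr0n; [|lia]; rewrite subn_eq0 leqNgt jm /= mulr0 oppr0.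
have [->|jm1] := eqVneq j m.
  by rewrite subnn expr0 mulr1 ffactnn /kap divfK ?subrr// pnatr_eq0 -lt0n fact_gt0.
(* The one order settled neither by flatness nor by the choice of [kap]. It is even, so oddness of
   [w0] makes the derivative vanish at [0]. *)
have -> : j = m.+1 by lia.
have := @odd_derive1n R w0 (2 * n + 3) delta w0_odd _ m.+1 0.
rewrite normr0 oppr0 => H.
have : derive1n m.+1 w0 0 = (-1) ^+ m.+2 * derive1n m.+1 w0 0.
  by apply: H => //; [move=> i x ij xd; have [] := w0_der ij xd|lia].
rewrite ffact_small// mulr0 mul0r subr0 -signr_odd.
have -> : odd m.+2 by rewrite addn1 /= mul2n odd_double.
by rewrite expr1 mulN1r => E; lra.
Qed.

(** The top derivative is merely continuous on an open interval, so it is bounded on a compact half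
    of it. As [2 * n + 3 = m + 2], the cases [i = m + 2], [m + 1], [m] are the three bounds that
    division by [y ^+ m] requires. *)
Lemma rest_bound : exists d C : R, [/\ 0 < d, d < delta, 0 <= C &
  forall i y, (i <= 2 * n + 3)%N -> `|y| < d ->
    `|leading_rest (2 * n + 3 - i) y| <= C * `|y| ^+ i].
Proof.
have dp := delta_gt0.
pose d := delta / 2; pose N := (2 * n + 3)%N.
have dd : - d <= d by rewrite /d; lra.
have cw : {within `[- d, d], continuous (fun y => `|leading_rest N y|)}.
  apply: continuous_in_subspaceT => y; rewrite inE /= in_itv /= => /andP[y1 y2].
  apply: cvg_norm; apply: cvgB.
    by apply: w0_Ck.2; rewrite /= in_itv /=; apply/andP; split; rewrite /d in y1 y2; lra.
  rewrite ffact_small; last by rewrite /N; lia.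
  under eq_fun do rewrite mulr0 mul0r.
  by rewrite mulr0 mul0r; exact: cvg_cst.
have [c _ cmax] := EVT_max dd cw.
have NC y : `|y| < d -> `|leading_rest N y| <= `|leading_rest N c|.
  by move=> yd; apply: cmax; rewrite in_itv /= -ler_norml ltW.
have ddl : d < delta by rewrite /d; lra.
exists d, `|leading_rest N c|; split => //; first by rewrite /d; lra.
apply: flat_bound => //; last exact: rest0.
by move=> j x jN xd; apply: rest_deriv => //; exact: lt_trans ddl.
Qed.

Section Fixed.
Variables (d C : R).
Hypotheses (d0 : 0 < d) (d_delta : d < delta) (C0 : 0 <= C).
Hypothesis restb : forall i y, (i <= 2 * n + 3)%N -> `|y| < d ->
  `|leading_rest (2 * n + 3 - i) y| <= C * `|y| ^+ i.

Let rest0b y : `|y| < d -> `|leading_rest 0 y| <= C * `|y| ^+ m.+2.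
Proof.
by move=> yd; have := restb (leqnn (2 * n + 3)) yd; rewrite subnn addn1 addn3.
Qed.

Let rest1b y : `|y| < d -> `|leading_rest 1 y| <= C * `|y| ^+ m.+1.
Proof.
move=> yd; have := restb (i := m.+1) _ yd.
have -> : (2 * n + 3 - m.+1 = 1)%N by lia.
by apply; lia.
Qed.

Let rest2b y : `|y| < d -> `|leading_rest 2 y| <= C * `|y| ^+ m.
Proof.
move=> yd; have := restb (i := m) _ yd.
have -> : (2 * n + 3 - m = 2)%N by lia.
by apply; lia.
Qed.

Let rest0d (y : R) : `|y| < d -> has_deriv (leading_rest 0) y (leading_rest 1 y).
Proof. by move=> yd; apply: rest_deriv; [lia|exact: lt_trans d_delta]. Qed.

Let rest1d (y : R) : `|y| < d -> has_deriv (leading_rest 1) y (leading_rest 2 y).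
Proof. by move=> yd; apply: rest_deriv; [lia|exact: lt_trans d_delta]. Qed.

(** The function [w0 y / y ^+ m] with its singularity removed: at [0] the quotient of the rest is
    [0], by division by zero, which leaves the correct value [kap]. *)
Let k (y : R) : R := kap + quot (leading_rest 0) m y.
Let dk : R -> R := dquot (leading_rest 0) (leading_rest 1) m.

Let kE y : y != 0 -> k y = w0 y / y ^+ m.
Proof.
move=> y0; rewrite /k /quot /leading_rest /= ffactn0 mulr1 subn0.
by field; rewrite expf_neq0.
Qed.

Let w0_meas : measurable_fun setT w0.
Proof. exact: continuous_measurable_fun. Qed.

Let kmeas : measurable_fun setT k.
Proof.
apply: measurable_funD => //; apply: measurable_funM.
  apply: measurable_funB => //.
  by apply: measurable_funM; [exact: measurable_cst|exact: measurable_funX].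
by apply: measurable_inv_fun; exact: measurable_funX.
Qed.

Let k_deriv (y : R) : `|y| < d -> has_deriv k y (dk y).
Proof.
move=> yd; rewrite -[dk y]add0r; apply: has_derivD; first exact: has_deriv_cst.
exact: (quot_deriv C0 d0).
Qed.

Let kN y : k (- y) = k y.
Proof.
rewrite /k /quot /leading_rest /= w0_odd ffactn0 subn0 mulr1 !(exprNn y).
have -> : (-1 : R) ^+ m = -1 by rewrite -signr_odd addn1 /= mul2n odd_double.
rewrite !mulN1r invrN mulrN -mulNr; congr (_ + _ * _); ring.
Qed.

Let dk0 : dk 0 = 0.
Proof.
have z0 : `|0 : R| < d by rewrite normr0.
apply/eqP; rewrite -normr_le0.
by rewrite (le_trans (dquot_bound C0 rest0b rest1b z0))// normr0 mulr0.
Qed.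

Let Kb := `|kap| + C * d ^+ 2.

Let k_bound y : `|y| < d -> `|k y| <= Kb.
Proof.
move=> yd; rewrite (le_trans (ler_normD _ _))// lerD2l.
rewrite (le_trans (quot_bound C0 rest0b yd))// ler_wpM2l// lerXn2r ?nnegrE//; exact: ltW.
Qed.

Let Kb0 : 0 <= Kb.
Proof. by rewrite addr_ge0// mulr_ge0// exprn_ge0// ltW. Qed.

Let far := Lfun2_div_integrable d0 w0_L2.

(** Flatness turns the integrand into [k y * y ^+ (m - j.+1)] near [0], which is bounded precisely
    because [j < m]. *)
Let moment_int j : (j < m)%N ->
  mu.-integrable setT (EFin \o (fun y => w0 y / y ^+ j / y)).
Proof.
move=> jm; have mj : measurable_fun setT (fun y => w0 y / y ^+ j / y).
  apply: measurable_funM; last exact: measurable_inv_fun.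
  apply: measurable_funM => //; apply: measurable_inv_fun; exact: measurable_funX.
apply: (@integrable_near_far R (fun y => w0 y / y) _ d (Kb * d ^+ (m - j.+1)) (d ^- j)) => //.
- by rewrite mulr_ge0// exprn_ge0// ltW.
- by rewrite invr_ge0 exprn_ge0// ltW.
- move=> y yd; have [->|y0] := eqVneq y 0.
    by rewrite invr0 mulr0 normr0 mulr_ge0// exprn_ge0// ltW.
  have -> : w0 y / y ^+ j / y = k y * y ^+ (m - j.+1).
    have E : y ^+ m = y ^+ (m - j.+1) * (y ^+ j * y).
      by rewrite -exprSr -exprD subnK.
    by rewrite kE// E; field; rewrite y0 !expf_neq0.
  rewrite normrM; apply: ler_pM => //; first exact: k_bound.
  by rewrite normrX; apply: lerXn2r; rewrite ?nnegrE ?normr_ge0 ?ltW.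
- move=> y dy; have y0 : 0 < `|y| by exact: lt_le_trans dy.
  rewrite -[w0 y / y ^+ j / y]mulrAC normrM mulrC ler_wpM2r//.
  rewrite normfV normrX lef_pV2 ?posrE ?exprn_gt0// lerXn2r// nnegrE ltW//.
Qed.

Let k_far : mu.-integrable setT (EFin \o (fun y => if `|y| < d then 0 else k y / y)).
Proof.
apply: (@integrable_near_far R (fun y => w0 y / y) _ d 0 (d ^- m)) => //.
- by rewrite invr_ge0 exprn_ge0// ltW.
- apply: measurable_fun_ifT => //.
    exact: measurable_norm_lt.
  by apply: measurable_funM => //; exact: measurable_inv_fun.
- by move=> y ->; rewrite normr0.
- move=> y dy; have y0 : 0 < `|y| by exact: lt_le_trans dy.
  rewrite ltNge dy /= kE -?normr_gt0// -[w0 y / y ^+ m / y]mulrAC normrM mulrC ler_wpM2r//.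
  rewrite normfV normrX lef_pV2 ?posrE ?exprn_gt0// lerXn2r// nnegrE ltW//.
Qed.

Let dk_lip : exists L : R, forall x y, `|x| < d -> `|y| < d ->
  `|dk x - dk y| <= L * `|x - y|.
Proof. exact: (dquot_lip C0 d0 rest0b rest1b rest2b rest0d rest1d). Qed.

(** [S 0] is the truncated integral of the Hilbert transform of [w0], before the factor [pi^-1]; the
    moments [B j] are the coefficients met on the way from [S 0] to [S m]. *)
Let S j (x e : R) := \int[mu]_(y in trunc x e) (w0 y / y ^+ j / (x - y)).
Let B j := \int[mu]_y (w0 y / y ^+ j / y).

Let S_int j (x e : R) : (j < m)%N -> 0 < e ->
  mu.-integrable (trunc x e) (EFin \o (fun y => w0 y / y ^+ j.+1 / (x - y))).
Proof.
move=> jm e0.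
have it : mu.-integrable (trunc x e) (EFin \o (fun y => w0 y / y ^+ j / y)).
  by apply: integrableS (moment_int jm) => //; exact: measurable_trunc.
have {}it : mu.-integrable (trunc x e) (fun y => e^-1%:E * (w0 y / y ^+ j / y)%:E)%E.
  by apply: integrableZl => //; exact: measurable_trunc.
apply: le_integrable it => //; first exact: measurable_trunc.
  apply/measurable_EFinP/measurable_funTS; apply: measurable_funM.
    by apply: measurable_funM => //; apply: measurable_inv_fun; exact: measurable_funX.
  by apply: measurable_inv_fun; exact: measurable_funB.
move=> y; rewrite /trunc /= => exy; rewrite lee_fin.
have -> : w0 y / y ^+ j.+1 = w0 y / y ^+ j / y by rewrite exprSr invfM mulrA.
rewrite mulrC normrM [leRHS]normrM ler_wpM2r// !normfV lef_pV2 ?posrE//.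
- by rewrite (gtr0_norm e0) ltW.
- exact: lt_trans exy.
- by rewrite normr_gt0 gt_eqF.
Qed.

(** One term of the geometric expansion: [1 / (x - y) = - 1 / y + x / (y (x - y))]. Only the second
    part is singular at [x]; the first one converges to a moment. *)
Let S_step j (x l : R) : (j < m)%N -> S j.+1 x e @[e --> 0^'+] --> l ->
  S j x e @[e --> 0^'+] --> (- B j) + x * l.
Proof.
move=> jm Sl.
have : (- \int[mu]_(y in trunc x e) (w0 y / y ^+ j / y)) + x * S j.+1 x e @[e --> 0^'+] --> (- B j) + x * l.
  apply: cvgD; last by apply: cvgM => //; exact: cvg_cst.
  by apply: cvgN; apply: cvg_trunc; exact: moment_int.
apply: cvg_trans; apply: near_eq_cvg; near=> e.
have e0 : 0 < e by [].
have iS := S_int x jm e0.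
have iB : mu.-integrable (trunc x e) (EFin \o (fun y => w0 y / y ^+ j / y)).
  by apply: integrableS (moment_int jm) => //; exact: measurable_trunc.
rewrite /S -RintegralZl//; last exact: measurable_trunc.
rewrite addrC -RintegralB//; first last.
- by have := iS; move=> /(integrableZl _ x); apply; exact: measurable_trunc.
- exact: measurable_trunc.
apply: eq_Rintegral => y; rewrite inE /trunc /= => exy.
have xy0 : x - y != 0 by rewrite -normr_gt0 (lt_trans e0).
have [->|y0] := eqVneq y 0.
  (* For [j = 0] the term at [y = 0] is [w0 0 / x], without any division by zero, so its vanishing
     rests on oddness. *)
  have -> : w0 0 = 0 by have := w0_odd 0; rewrite oppr0 => E; lra.
  by rewrite !mul0r mulr0 subrr.
rewrite exprSr invfM; field.
by rewrite xy0 y0 expf_neq0.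
Unshelve. all: end_near. Qed.

(* [w0 y / y ^+ m] is [0] at [y = 0], where division is by zero, and not [k 0]. *)
Let S_top (L x : R) :
  (forall x y, `|x| < d -> `|y| < d -> `|dk x - dk y| <= L * `|x - y|) ->
  `|x| < d / 2 -> S m x e @[e --> 0^'+] --> pv k dk d x.
Proof.
move=> Ldk xd; have := cvg_pv d0 kmeas k_far k_deriv Ldk xd.
apply: cvg_trans; apply: near_eq_cvg; near=> e.
have e0 : 0 < e by [].
apply/esym/(@Rintegral_eq_off _ _ 0).
- exact: measurable_trunc.
- have -> : m = (2 * n).+1 by rewrite addn1.
  by apply: S_int => //; rewrite addn1.
- apply: measurable_funTS; apply: measurable_funM => //.
  by apply: measurable_inv_fun; exact: measurable_funB.
- by move=> y _ /eqP y0; rewrite kE.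
Unshelve. all: end_near. Qed.

Let B_odd j : (j < m)%N -> odd j -> B j = 0.
Proof.
move=> jm oj; apply: Rintegral_odd => //; first exact: moment_int.
  apply: measurable_funM; last exact: measurable_inv_fun.
  apply: measurable_funM => //; apply: measurable_inv_fun; exact: measurable_funX.
move=> y; rewrite w0_odd exprNn -signr_odd oj expr1 mulN1r !invrN mulrNN.
by rewrite mulrN.
Qed.

Let B_even j : (j < m)%N -> ~~ odd j -> B j < 0.
Proof.
move=> jm oj; have pj (y : R) : 0 <= y ^+ j by rewrite exprn_even_ge0.
suff : 0 < - B j by rewrite oppr_gt0.
have sq y : w0 y / y ^+ j / y = (w0 y * y) / (y ^+ j * y ^+ 2).
  have [->|y0] := eqVneq y 0; first by rewrite invr0 !mulr0 mul0r.
  by field; rewrite y0 expf_neq0.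
have w0y y : w0 y * y <= 0.
  have [y0|y0|->] := ltgtP y 0; last by rewrite mulr0.
  - by have := w0_neg (x := - y); rewrite oppr_gt0 w0_odd => /(_ y0); nra.
  - by have := w0_neg y0; nra.
(* Strict positivity only takes a lower bound on one interval away from [0]. On [[1, 2]] the maximum
   of the negative function [w0] and [y <= 2] provide it. *)
have cw : {within `[1, 2 : R], continuous w0}.
  by apply: continuous_subspaceT.
have [c] := EVT_max (ler1n R 2) cw; rewrite in_itv/= => /andP[c1 c2] cmax.
have wc : w0 c < 0 by apply: w0_neg; lra.
have -> : - B j = \int[mu]_y (-1 * (w0 y / y ^+ j / y)).
  by rewrite RintegralZl// ?mulN1r//; exact: moment_int.
apply: (@Rintegral_gt0 _ _ 1 2 (- w0 c / (2 ^+ j * 2 ^+ 2))).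
- by rewrite ltr1n.
- by rewrite divr_gt0 ?oppr_gt0// mulr_gt0// exprn_gt0.
- exact: (integrableZl measurableT (-1) (moment_int jm)).
- by move=> y; rewrite mulN1r oppr_ge0 sq mulr_le0_ge0 // invr_ge0 mulr_ge0 // sqr_ge0.
- move=> y /andP[y1 y2]; rewrite mulN1r sq -mulNr.
  have y0 : 0 < y by lra.
  have wy : w0 y <= w0 c by apply: cmax; rewrite in_itv /= y1 y2.
  apply: ler_pM.
  + by rewrite oppr_ge0 ltW.
  + by rewrite invr_ge0 mulr_ge0// exprn_ge0.
  + have := w0_neg y0; nra.
  + rewrite lef_pV2 ?posrE ?mulr_gt0 ?exprn_gt0//.
    by apply: ler_pM; [exact: pj|exact: sqr_ge0| |]; apply: lerXn2r; rewrite ?nnegrE //; lra.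
Qed.

(** Induction downwards from order [2 * n], two orders per round: the odd moment in between
    vanishes, so a round multiplies by [x ^+ 2] and adds one coefficient. Only the two lowest
    coefficients are tracked, for they determine the value and the second derivative at [0]. *)
Let S_poly (L : R) i :
  (forall x y, `|x| < d -> `|y| < d -> `|dk x - dk y| <= L * `|x - y|) ->
  (i <= n)%N -> exists P : {poly R}, [/\
    forall x : R, `|x| < d / 2 ->
      S (2 * (n - i)) x e @[e --> 0^'+] --> P.[x ^+ 2] + x ^+ (2 * i + 1) * pv k dk d x,
    P`_0 = - B (2 * (n - i)) &
    (0 < i)%N -> P`_1 = - B (2 * (n - i) + 2)].
Proof.
move=> Ldk; elim: i => [_|i IH iN].
  exists (- B (2 * n))%:P; rewrite subn0 coefC; split => // x xd.
  rewrite hornerC muln0 expr1; apply: S_step; first by clear; lia.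
  by have := S_top Ldk xd; rewrite addn1.
have [P [PS P0 P1]] := IH (ltnW iN).
have E1 : (2 * (n - i) = (2 * (n - i.+1)).+2)%N by clear - iN; lia.
have E3 : ((2 * (n - i.+1)).+1 < m)%N by clear - iN; lia.
have E2 : (2 * (n - i.+1) + 2 = 2 * (n - i))%N by rewrite E1 addn2.
exists ((- B (2 * (n - i.+1)))%:P + P * 'X); split.
- move=> x xd; have := PS x xd; rewrite {1}E1 => H.
  have {}H := S_step E3 H.
  rewrite B_odd /= ?oppr0 ?add0r in H; [|exact: E3|by rewrite mul2n odd_double].
  have {}H := S_step (ltnW E3) H.
  rewrite hornerD hornerC hornerM hornerX.
  suff -> : - B (2 * (n - i.+1)) + P.[x ^+ 2] * x ^+ 2 + x ^+ (2 * i.+1 + 1) * pv k dk d x =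
     - B (2 * (n - i.+1)) + x * (x * (P.[x ^+ 2] + x ^+ (2 * i + 1) * pv k dk d x)) by [].
  by rewrite mulnS -addnA [in LHS]exprD; ring.
- by rewrite coefD coefC coefMX /= addr0.
- by move=> _; rewrite coefD coefC coefMX /= add0r P0 E2.
Qed.

Let hilbert_expansion_fixed : exists (P : {poly R}) (K : R -> R), [/\
  forall x, `|x| < d / 2 -> hilbert w0 x = P.[x ^+ 2] + x ^+ m * K x,
  K 0 = 0,
  exists2 C1 : R, 0 <= C1 & forall x, `|x| < d / 2 ->
    exists2 l, has_deriv K x l & `|l| <= C1,
  0 < P`_0 & 0 < P`_1].
Proof.
have [L Ldk] := dk_lip.
have [P [PS P0 P1]] := S_poly Ldk (leqnn n).
have pi0 : 0 < (pi : R)^-1 by rewrite invr_gt0 pi_gt0.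
exists (pi^-1 *: P), (fun x => pi^-1 * pv k dk d x); split.
- move=> x xd; have := PS x xd; rewrite subnn muln0 => /(cvg_lim (@Rhausdorff R)) H.
  rewrite hornerZ mulrCA -mulrDr -H /hilbert.
  suff -> : (fun e : R => \int[mu]_(y in [set y : R | (e < `|x - y|)%R])
    (w0 y / (x - y))) = S 0 x by [].
  by apply/funext => e; apply: eq_Rintegral => y _; rewrite expr0 divr1.
- by rewrite (pv0 d0 kmeas k_far k_deriv Ldk kN dk0) mulr0.
- have [C1 C10 H] := pv_deriv d0 kmeas k_far k_deriv Ldk.
  exists (pi^-1 * C1); first by rewrite mulr_ge0// ltW.
  move=> x /H[l dl lC]; exists (pi^-1 * l).
    apply: has_deriv_eq; first by apply: has_derivM dl; exact: has_deriv_cst.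
    by rewrite mulr0 addr0.
  by rewrite normrM (gtr0_norm pi0) ler_wpM2l// ltW.
- by rewrite coefZ P0 subnn mulr_gt0// oppr_gt0 B_even//; clear -n_ge1; lia.
- rewrite coefZ P1// subnn mulr_gt0// oppr_gt0 B_even//; clear -n_ge1; lia.
Qed.

Lemma local_expansion_fixed : exists (P : {poly R}) (K : R -> R) (C1 : R), [/\
  forall x, `|x| < d / 2 -> hilbert w0 x = P.[x ^+ 2] + x ^+ m * K x,
  K 0 = 0,
  0 <= C1 /\ forall x, `|x| < d / 2 -> exists2 l, has_deriv K x l & `|l| <= C1,
  0 < P`_0 /\ 0 < P`_1 &
  forall x, `|x| < d / 2 -> `|w0 x - kap * x ^+ m| <= C * `|x| ^+ m.+2].
Proof.
have [P [K [H1 H2 [C1 C10 H3] H4 H5]]] := hilbert_expansion_fixed.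
exists P, K, C1; split => // x xd.
have := @rest0b x; rewrite /leading_rest /= ffactn0 subn0 mulr1; apply.
have := d0; lra.
Qed.

End Fixed.

Lemma hilbert_local_expansion : exists (P : {poly R}) (K : R -> R) (d C : R), [/\
  0 < d /\ 0 <= C,
  forall x, `|x| < d -> hilbert w0 x = P.[x ^+ 2] + x ^+ m * K x,
  K 0 = 0 /\ forall x, `|x| < d -> exists2 l, has_deriv K x l & `|l| <= C,
  0 < P`_0 /\ 0 < P`_1 &
  forall x, `|x| < d ->
    `|w0 x - derive1n m w0 0 / m`!%:R * x ^+ m| <= C * `|x| ^+ m.+2].
Proof.
have [d [C [d0 dd C0 rb]]] := rest_bound.
have [P [K [C1 [H1 H2 [C10 H3] H4 H5]]]] := local_expansion_fixed d0 dd C0 rb.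
exists P, K, (d / 2), (C + C1); split => //.
- by rewrite divr_gt0// addr_ge0.
- split=> // x /H3[l dl lC]; exists l => //; lra.
- move=> x /H5 /le_trans; apply; rewrite ler_wpM2r ?exprn_ge0//; lra.
Qed.

End Expansion.

(** * The second derivative at the origin *)

Section SecondDerivative.
Context {R : realType}.

Lemma has_deriv_horner (p : {poly R}) (x : R) : has_deriv (horner p) x (deriv p).[x].
Proof.
elim/poly_ind: p => [|p c IH].
  have -> : horner 0 = (fun=> 0 : R) by apply/funext => y; rewrite horner0.
  by rewrite deriv0 horner0; exact: has_deriv_cst.
have -> : horner (p * 'X + c%:P) = (fun y => p.[y] * y + c).
  by apply/funext => y; rewrite !hornerE.
apply: has_deriv_eq.
  apply: has_derivD; last exact: has_deriv_cst.
  by apply: has_derivM IH _; exact: has_deriv_id.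
by rewrite derivD derivM derivX derivC !hornerE; ring.
Qed.

Lemma has_deriv_lip0 (K : R -> R) (d C : R) : K 0 = 0 -> 0 <= C ->
  (forall x, `|x| < d -> exists2 l, has_deriv K x l & `|l| <= C) ->
  forall x, `|x| < d -> `|K x| <= C * `|x|.
Proof.
move=> K0 C0 dK x xd.
have z : `|0 : R| < d by rewrite normr0 (le_lt_trans _ xd).
have dK' c : `|c| < d -> has_deriv K c (derive1 K c) /\ `|derive1 K c| <= C.
  by move=> /dK[l dl lC]; rewrite (has_deriv_derive1 dl).
have [c cb|c cb] := @MVT_between R K (derive1 K) 0 x.
  by have [] := dK' c (between_norm z xd cb).
rewrite K0 !subr0 => ->; rewrite normrM ler_wpM2r//.
by have [] := dK' c (between_norm z xd cb).
Qed.

(** Only one derivative of [K] is available. The part [rem] of the first derivative of [h] in which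
    [K] occurs is [O(x^2)], thanks to [n >= 1] and [K 0 = 0], hence differentiable at [0] with
    derivative [0]. *)
Lemma second_derivative (h K : R -> R) (P : {poly R}) (n : nat) (d C : R) :
  (1 <= n)%N -> 0 < d ->
  (forall x, `|x| < d -> h x = P.[x ^+ 2] + x ^+ (2 * n + 1) * K x) ->
  K 0 = 0 -> 0 <= C ->
  (forall x, `|x| < d -> exists2 l, has_deriv K x l & `|l| <= C) ->
  derive1n 2 h 0 = 2 * P`_1.
Proof.
move=> n1 d0 hE K0 C0 dK.
have Kb := has_deriv_lip0 K0 C0 dK.
have dK' x : `|x| < d -> has_deriv K x (derive1 K x) /\ `|derive1 K x| <= C.
  by move=> /dK[l dl lC]; rewrite (has_deriv_derive1 dl).
pose rem x := x ^+ (2 * n + 1) * derive1 K x + K x * ((2 * n + 1)%:R * x ^+ (2 * n)).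
have dh x : `|x| < d -> derive1 h x = (deriv P).[x ^+ 2] * (2 * x) + rem x.
  move=> xd; apply: has_deriv_derive1.
  apply: (has_deriv_near (f := fun x => P.[x ^+ 2] + x ^+ (2 * n + 1) * K x)).
    near=> y; rewrite hE//; near: y.
    exact: (cvgr_lt _ (cvg_norm cvg_id)).
  apply: has_derivD.
    apply: has_deriv_eq.
      by apply: (has_deriv_comp (f := horner P)); [exact: has_deriv_horner|exact: has_deriv_pow].
    by rewrite expr1.
  apply: has_deriv_eq.
    by apply: has_derivM; [exact: has_deriv_pow|exact: (dK' x xd).1].
  by rewrite /rem addn1.
have remb x : `|x| < Num.min d 1 -> `|rem x| <= C * (2 * n + 2)%:R * `|x| ^+ 2.
  rewrite lt_min => /andP[xd x1].
  have x2 : `|x| ^+ (2 * n + 1) <= `|x| ^+ 2.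
    by rewrite ler_wiXn2l ?normr_ge0 ?(ltW x1)//; lia.
  have x3 : `|x| ^+ (2 * n) <= `|x| by rewrite -{2}[`|x|]expr1 ler_wiXn2l ?normr_ge0 ?(ltW x1)//; lia.
  rewrite (le_trans (ler_normD _ _))//.
  have -> : C * (2 * n + 2)%:R * `|x| ^+ 2 =
    `|x| ^+ 2 * C + (C * `|x|) * ((2 * n + 1)%:R * `|x|) by rewrite !natrD; ring.
  rewrite lerD// !normrM ?normrX.
    by apply: ler_pM => //; exact: (dK' x xd).2.
  by rewrite normr_nat; apply: ler_pM => //; rewrite ?Kb ?ler_wpM2l ?mulr_ge0 ?exprn_ge0.
have rem0 : rem 0 = 0.
  apply/eqP; rewrite -normr_le0 (le_trans (remb 0 _)) ?normr0 ?expr0n ?mulr0//.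
  by rewrite lt_min d0 ltr01.
have drem : has_deriv rem 0 0.
  apply: (has_deriv_flat (d := Num.min d 1) (C := C * (2 * n + 2)%:R)).
    by rewrite lt_min d0 ltr01.
  by move=> y; rewrite rem0 !subr0; exact: remb.
change (derive1 (derive1 h) 0 = 2 * P`_1).
apply: has_deriv_derive1.
apply: (has_deriv_near (f := fun x => (deriv P).[x ^+ 2] * (2 * x) + rem x)).
  near=> y; rewrite dh//; near: y.
apply: has_deriv_eq.
  apply: has_derivD drem; apply: has_derivM.
    apply: (has_deriv_comp (f := horner (deriv P))); first exact: has_deriv_horner.
    exact: has_deriv_pow.
  by apply: has_derivM; [exact: has_deriv_cst|exact: has_deriv_id].
rewrite !expr0n /= horner_coef0 coef_deriv mulr1n; ring.
Unshelve. all: end_near. Qed.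
End SecondDerivative.

(** * Hilbert transform of the Cauchy kernel *)

Section CauchyKernel.
Context {R : realType}.
Notation mu := (@lebesgue_measure R).
Variables (A B : R).
Hypotheses (A0 : 0 < A) (B0 : 0 < B).

Let D x := A ^+ 2 + B ^+ 2 * x ^+ 2.
Let f y := (D y)^-1.

Let D_gt0 x : 0 < D x.
Proof. by rewrite /D ltr_pwDl ?exprn_gt0// mulr_ge0// sqr_ge0. Qed.

Let f_meas : measurable_fun setT f.
Proof.
apply: measurable_inv_fun; apply: measurable_funD => //.
by apply: measurable_funM => //; exact: measurable_funX.
Qed.

Let f_int : mu.-integrable setT (EFin \o f).
Proof.
have i := integrableZl measurableT (A ^- 2 + B ^- 2) (@integrable_oneDsqrV R).
apply: le_integrable i => //; first exact/measurable_EFinP.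
move=> y _ /=; rewrite lee_fin.
have y2 : 0 < 1 + y ^+ 2 by rewrite ltr_pwDl// sqr_ge0.
have a2 : 0 < A ^+ 2 by rewrite exprn_gt0.
have b2 : 0 < B ^+ 2 by rewrite exprn_gt0.
rewrite !ger0_norm; last first.
- by rewrite invr_ge0 ltW// D_gt0.
- by rewrite mulr_ge0 ?addr_ge0 ?invr_ge0 ?ltW.
rewrite /f -div1r ler_pdivrMr ?D_gt0// mulrAC ler_pdivlMr// mul1r.
rewrite /D; have -> : (A ^- 2 + B ^- 2) * (A ^+ 2 + B ^+ 2 * y ^+ 2) =
  1 + y ^+ 2 + (A ^+ 2 / B ^+ 2 + B ^+ 2 / A ^+ 2 * y ^+ 2).
  by field; rewrite !gt_eqF.
rewrite lerDl addr_ge0 //; first by rewrite divr_ge0 // ltW.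
by rewrite mulr_ge0 ?sqr_ge0 // divr_ge0 // ltW.
Qed.

Let g x y := f y / (x - y).

Let g_meas x : measurable_fun setT (g x).
Proof.
by apply: measurable_funM => //; apply: measurable_inv_fun; exact: measurable_funB.
Qed.

Let g_int x e : 0 < e -> mu.-integrable (trunc x e) (EFin \o g x).
Proof.
move=> e0.
have it : mu.-integrable (trunc x e) (fun y => e^-1%:E * (f y)%:E)%E.
  apply: integrableZl; first exact: measurable_trunc.
  by apply: integrableS f_int => //; exact: measurable_trunc.
apply: le_integrable it; first exact: measurable_trunc.
  by apply/measurable_EFinP/measurable_funTS; exact: g_meas.
move=> y; rewrite /trunc /= => exy; rewrite lee_fin.
rewrite /g mulrC normrM [leRHS]normrM ler_wpM2r// !normfV lef_pV2 ?posrE//.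
- by rewrite (gtr0_norm e0) ltW.
- exact: lt_trans exy.
- by rewrite normr_gt0 gt_eqF.
Qed.

(* A primitive of [g x] beyond [x]; writing the logarithm in terms of
   [1 / (y - x)] makes its limit at infinity a matter of continuity. *)
Let prim x y : R := (D x)^-1 * (B * x / A * atan (B / A * y) +
  2^-1 * ln (B ^+ 2 + 2 * B ^+ 2 * x * (y - x)^-1 + D x * (y - x)^-1 ^+ 2)).

Let qE x y : x != y -> B ^+ 2 + 2 * B ^+ 2 * x * (y - x)^-1 + D x * (y - x)^-1 ^+ 2 =
  D y * (y - x)^-1 ^+ 2.
Proof.
move=> xy; have xy0 : y - x != 0 by rewrite subr_eq0 eq_sym.
by rewrite /D; field.
Qed.

Let q_gt0 x y : x != y ->
  0 < B ^+ 2 + 2 * B ^+ 2 * x * (y - x)^-1 + D x * (y - x)^-1 ^+ 2.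
Proof.
move=> xy; have xy0 : y - x != 0 by rewrite subr_eq0 eq_sym.
by rewrite qE// mulr_gt0 ?D_gt0// exprn_even_gt0//= invr_neq0.
Qed.

(** Partial fractions: [D x - D y = B^2 (x - y) (x + y)] gives [1 / (D y (x - y)) = (1 / (x - y) +
    B^2 (x + y) / D y) / D x], whose terms integrate to two logarithms and an arctangent. *)
Let prim_deriv x y : x < y -> has_deriv (prim x) y (g x y).
Proof.
move=> xy; have xny : x != y by rewrite lt_eqF.
have xy0 : y - x != 0 by rewrite subr_eq0 eq_sym.
have yx0 : x - y != 0 by rewrite subr_eq0.
have dv : has_deriv (fun y => (y - x)^-1) y (- (1 + 0) / (y - x) ^+ 2).
  apply: has_derivV => //.
  by apply: has_derivD; [exact: has_deriv_id|exact: has_deriv_cst].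
apply: has_deriv_eq.
  apply: has_derivM; first exact: has_deriv_cst.
  apply: has_derivD.
    apply: has_derivM; first exact: has_deriv_cst.
    apply: (has_deriv_comp (f := atan)); first exact: is_derive1_atan.
    by apply: has_derivM; [exact: has_deriv_cst|exact: has_deriv_id].
  apply: has_derivM; first exact: has_deriv_cst.
  apply: has_deriv_ln; first exact: q_gt0.
  apply: has_derivD; last first.
    by apply: has_derivM; [exact: has_deriv_cst|apply: has_derivX; exact: dv].
  apply: has_derivD; first exact: has_deriv_cst.
  by apply: has_derivM; [exact: has_deriv_cst|exact: dv].
rewrite /= qE // /g /f.
have Dx0 : D x != 0 by rewrite gt_eqF ?D_gt0.
have Dy0 : D y != 0 by rewrite gt_eqF ?D_gt0.
have A0' : A != 0 by rewrite gt_eqF.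
have -> : 1 + (B / A * y) ^+ 2 = D y / A ^+ 2 by rewrite /D; field.
rewrite invf_div.
move: Dx0 Dy0; rewrite /D => Dx0 Dy0; field.
by rewrite yx0 xy0 A0' !exprMn Dx0 Dy0.
Qed.

Let prim_lim x : prim x y @[y --> +oo] --> (D x)^-1 * (B * x / A * (pi / 2) + 2^-1 * ln (B ^+ 2)).
Proof.
have B2 : 0 < B ^+ 2 by rewrite exprn_gt0.
have vlim : (y - x)^-1 @[y --> +oo] --> (0 : R).
  apply/cvgr0Pnorm_lt => e e0; near=> y.
  have xy : x + e^-1 < y by near: y; apply: nbhs_pinfty_gt; exact: num_real.
  have ei : 0 < e^-1 by rewrite invr_gt0.
  have yx : 0 < y - x by lra.
  by rewrite normfV gtr0_norm// invf_plt ?posrE//; lra.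
have v2lim : (y - x)^-1 ^+ 2 @[y --> +oo] --> (0 : R).
  under eq_fun do rewrite expr2.
  have H := cvgM vlim vlim; rewrite mulr0 in H; exact: H.
apply: cvgM; first exact: cvg_cst.
apply: cvgD.
  apply: cvgM; first exact: cvg_cst.
  apply: (cvg_comp (fun y => B / A * y) atan); last exact: cvgy_atan.
  by apply: gt0_cvgMry; [rewrite divr_gt0|exact: cvg_id].
apply: cvgM; first exact: cvg_cst.
apply: (cvg_comp (fun y => B ^+ 2 + 2 * B ^+ 2 * x * (y - x)^-1 +
  D x * (y - x)^-1 ^+ 2) (@ln R)); last exact: continuous_ln.
have l1 : 2 * B ^+ 2 * x * (y - x)^-1 @[y --> +oo] --> 2 * B ^+ 2 * x * 0.
  by apply: cvgM => //; exact: cvg_cst.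
have l2 : D x * (y - x)^-1 ^+ 2 @[y --> +oo] --> D x * 0.
  by apply: cvgM => //; exact: cvg_cst.
rewrite !mulr0 in l1 l2.
have H := cvgD (cvgD (cvg_cst (B ^+ 2)) l1) l2; rewrite !addr0 in H; exact: H.
Unshelve. all: end_near. Qed.

Let l x : R := (D x)^-1 * (B * x / A * (pi / 2) + 2^-1 * ln (B ^+ 2)).

Let f_cont y : {for y, continuous f}.
Proof.
apply: cvgV; first by rewrite gt_eqF ?D_gt0.
apply: cvgD; first exact: cvg_cst.
by apply: cvgM; [exact: cvg_cst|exact: exprn_continuous].
Qed.

Let g_right x e : 0 < e ->
  \int[mu]_(y in `[x + e, +oo[) g x y = l x - prim x (x + e).
Proof.
move=> e0.
have dp y : x < y -> {for y, continuous (prim x)}.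
  by move=> xy; apply: differentiable_continuous; have [dy _] := prim_deriv xy; exact/derivable1_diffP.
suff H : (\int[mu]_(y in `[(x + e)%R, +oo[) (g x y)%:E =
    (l x)%:E - (prim x (x + e))%:E)%E by rewrite /Rintegral H.
apply: le0_continuous_FTC2y.
- move=> y xy; have xy0 : x - y < 0 by lra.
  by rewrite /g mulr_ge0_le0 ?invr_le0 ?invr_ge0 ?ltW ?D_gt0.
- apply: continuous_in_subspaceT => y; rewrite inE /= in_itv /= andbT => xy.
  apply: cvgM; first exact: f_cont.
  apply: cvgV; first by rewrite lt_eqF// subr_lt0; lra.
  by apply: cvgB; [exact: cvg_cst|exact: cvg_id].
- exact: prim_lim.
- by apply: cvg_at_right_filter; apply: dp; lra.
- by move=> y xy; have [] : has_deriv (prim x) y (g x y) by apply: prim_deriv; lra.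
- move=> y; rewrite in_itv /= andbT => xy; apply: has_deriv_derive1.
  by apply: prim_deriv; lra.
Qed.

Let trunc_setU (x e : R) : 0 < e ->
  trunc x e = `]-oo, x - e[%classic `|` `]x + e, +oo[%classic.
Proof.
move=> e0; rewrite truncE; apply/seteqP; split => y /=; rewrite !in_itv /= andbT.
  by move=> /negP; rewrite negb_and -!ltNge => /orP.
by move=> h; apply/negP; rewrite negb_and -!ltNge; exact/orP.
Qed.

(** Reflection carries the left half-line at [x] to the right half-line at [- x] and changes the
    sign of the integrand, so a primitive to the right of the singularity is enough. *)
Let g_trunc x e : 0 < e -> \int[mu]_(y in trunc x e) g x y =
  (l x - prim x (x + e)) - (l (- x) - prim (- x) (- x + e)).
Proof.
move=> e0; have ig := g_int x e0; have ign := g_int (- x) e0.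
rewrite trunc_setU// in ig *; rewrite trunc_setU// in ign.
have ir : mu.-integrable `]x + e, +oo[ (EFin \o g x).
  by apply: integrableS ig => //; exact: measurableU.
have irn : mu.-integrable `](- x) + e, +oo[ (EFin \o g (- x)).
  by apply: integrableS ign => //; exact: measurableU.
rewrite Rintegral_setU//; last first.
  apply/disj_setPS => y [/=]; rewrite !in_itv/= andbT => ? ?; lra.
rewrite [X in _ + X]Rintegral_itv_obnd_cbnd// g_right// addrC; congr (_ + _).
have pre : -%R @^-1` `]-oo, x - e[ = `](- x) + e, +oo[%classic.
  by apply/seteqP; split => y /=; rewrite !in_itv /= ?andbT; lra.
have gN : (fun y => g x (- y)) = (fun y => -1 * g (- x) y).
  apply/funext => y; rewrite /g /f /D sqrrN opprK mulN1r -mulrN -invrN; congr (_ * _^-1).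
  ring.
rewrite Rintegral_oppr//; last first.
  by rewrite pre gN; move: irn => /(integrableZl _ (-1)); apply.
by rewrite pre gN RintegralZl// Rintegral_itv_obnd_cbnd// g_right// mulN1r.
Qed.

(** The truncated integral equals [r e] exactly: the logarithms of [e] and those coming from
    infinity cancel between the two sides, and the limits of the arctangent leave [pi]. The
    differences remaining in [r] are continuous and vanish at [e = 0]. *)
Lemma hilbert_cauchy_cvg (x : R) :
  \int[mu]_(y in trunc x e) ((A ^+ 2 + B ^+ 2 * y ^+ 2)^-1 / (x - y)) @[e --> 0^'+]
  --> pi * (B * x / A / (A ^+ 2 + B ^+ 2 * x ^+ 2)).
Proof.
have DN : D (- x) = D x by rewrite /D sqrrN.
pose r e : R := pi * (B * x / A / D x) + (D x)^-1 *
  (2^-1 * (ln (D (x - e)) - ln (D (x + e))) +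
   B * x / A * (atan (B / A * (x - e)) - atan (B / A * (x + e)))).
have : r e @[e --> 0^'+] --> r 0.
  apply: cvg_at_right_filter.
  have cx1 : x - e @[e --> 0] --> x - 0.
    by apply: cvgB; [exact: cvg_cst|exact: cvg_id].
  have cx2 : x + e @[e --> 0] --> x + 0.
    by apply: cvgD; [exact: cvg_cst|exact: cvg_id].
  have cD u : {for u, continuous D}.
    apply: cvgD; first exact: cvg_cst.
    by apply: cvgM; [exact: cvg_cst|exact: exprn_continuous].
  have clD (h : R -> R) u : h e @[e --> 0] --> u -> ln (D (h e)) @[e --> 0] --> ln (D u).
    move=> hu; apply: (continuous_cvg _ (continuous_ln (D_gt0 u))).
    exact: (continuous_cvg _ (cD u)).
  have cat (h : R -> R) u : h e @[e --> 0] --> u ->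
      atan (B / A * h e) @[e --> 0] --> atan (B / A * u).
    move=> hu; apply: (continuous_cvg _ (@continuous_atan R (B / A * u))).
    by apply: cvgM; [exact: cvg_cst|].
  apply: cvgD; first exact: cvg_cst.
  apply: cvgM; first exact: cvg_cst.
  apply: cvgD; (apply: cvgM; first exact: cvg_cst); apply: cvgB.
  - exact: clD. - exact: clD. - exact: cat. - exact: cat.
rewrite {2}/r subr0 addr0 !subrr !mulr0 addr0 mulr0 addr0.
apply: cvg_trans; apply: near_eq_cvg; near=> e.
have e0 : 0 < e by [].
rewrite g_trunc // /l DN.
have primE u : prim u (u + e) = (D u)^-1 * (B * u / A * atan (B / A * (u + e)) +
    2^-1 * (ln (D (u + e)) + ln (e^-1 ^+ 2))).
  rewrite /prim qE; last by rewrite lt_eqF// ltrDl.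
  by rewrite addrAC subrr add0r lnM ?posrE ?D_gt0// exprn_gt0// invr_gt0.
rewrite !primE DN.
have -> : D (- x + e) = D (x - e) by rewrite /D; ring.
have -> : B / A * (- x + e) = - (B / A * (x - e)) by ring.
rewrite atanN /r.
have A1 : A != 0 by rewrite gt_eqF.
have D1 : D x != 0 by rewrite gt_eqF ?D_gt0.
by move: (D x) D1 => Dx D1; field; rewrite A1 D1.
Unshelve. all: end_near. Qed.

Lemma hilbert_cauchy (C x : R) :
  hilbert (fun y => C / (A ^+ 2 + B ^+ 2 * y ^+ 2)) x =
  C * (B * x / A / (A ^+ 2 + B ^+ 2 * x ^+ 2)).
Proof.
rewrite /hilbert.
have : C * \int[mu]_(y in trunc x e) g x y @[e --> 0^'+] -->
    C * (pi * (B * x / A / (A ^+ 2 + B ^+ 2 * x ^+ 2))).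
  by apply: cvgM; [exact: cvg_cst|exact: hilbert_cauchy_cvg].
move=> H0; suff H : \int[mu]_(y in trunc x e) (C / (A ^+ 2 + B ^+ 2 * y ^+ 2) / (x - y))
    @[e --> 0^'+] --> C * (pi * (B * x / A / (A ^+ 2 + B ^+ 2 * x ^+ 2))).
  rewrite [lim _](cvg_lim (@Rhausdorff R) H) mulrCA mulKf//.
  by rewrite gt_eqF// pi_gt0.
apply: cvg_trans H0; apply: near_eq_cvg; near=> e.
have e0 : 0 < e by [].
rewrite -RintegralZl; [|exact: measurable_trunc|exact: g_int].
by apply: eq_Rintegral => y _; rewrite mulrA.
Unshelve. all: end_near. Qed.

End CauchyKernel.

Lemma hilbert_Omega2 (R : realType) (a b c : R) (n : nat) (z : R) :
  0 < a -> 0 < b -> 0 < c ->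
  hilbert (Omega2 a b c n) z =
  - (a * b `^ ((4 * n + 3)%:R / 2) * z
     / (a ^+ (4 * n) * c ^+ 2 + b ^+ (2 * n + 2) * z ^+ 2)).
Proof.
move=> a0 b0 c0.
(* Square roots of the two coefficients of the denominator. The power of [b] in the numerator then
   comes from [(4n + 3) / 2 = (n + 1) + (2n + 1) / 2]. *)
pose A := a ^+ (2 * n) * c; pose B := b ^+ n.+1.
have A0 : 0 < A by rewrite mulr_gt0// exprn_gt0.
have B0 : 0 < B by rewrite exprn_gt0.
have A2 : a ^+ (4 * n) * c ^+ 2 = A ^+ 2.
  by rewrite exprMn -exprM; congr (_ ^+ _ * _); lia.
have B2 : b ^+ (2 * n + 2) = B ^+ 2 by rewrite -exprM; congr (_ ^+ _); lia.
have -> : Omega2 a b c n = fun y =>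
    (- (a ^+ (2 * n + 1) * b `^ ((2 * n + 1)%:R / 2) * c)) / (A ^+ 2 + B ^+ 2 * y ^+ 2).
  by apply/funext => y; rewrite /Omega2 A2 B2 mulNr.
rewrite hilbert_cauchy// A2 B2.
have -> : b `^ ((4 * n + 3)%:R / 2) = B * b `^ ((2 * n + 1)%:R / 2).
  rewrite /B -powR_mulrn ?ltW// -powRD; last by rewrite (gt_eqF b0) implybT.
  by congr (_ `^ _); rewrite (natrD _ (4 * n)) (natrD _ (2 * n)) !natrM -natr1; field.
have D0 : A ^+ 2 + B ^+ 2 * z ^+ 2 != 0.
  by rewrite gt_eqF// ltr_pwDl ?exprn_gt0// mulr_ge0// sqr_ge0.
rewrite exprD expr1 /A; rewrite /A in D0; move: (b `^ _) => bb.
have c1 : c != 0 by rewrite gt_eqF.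
have a1 : a ^+ (2 * n) != 0 by rewrite expf_neq0// gt_eqF.
move: (B) (a ^+ (2 * n)) D0 a1 => B1 a2 D0 a1.
by rewrite -exprMn in D0; field; rewrite D0 c1 a1.
Qed.

(** * Orders of magnitude *)

Section Order.
Context {R : realType} {I : Type}.
Variables (dom : I -> Prop) (s : I -> R).
Implicit Types (F G : I -> R) (j k : nat).

(** Uniform over [dom]: the index will be the pair [(t, x)] and [s] the square root of [T - t], so
    that one constant serves every [x] of the window. The bound [e <= 1] lets a higher order imply a
    lower one. *)
Definition bigO k F : Prop := exists C e : R, [/\ 0 <= C, 0 < e, e <= 1 &
  forall i, dom i -> 0 < s i < e -> `|F i| <= C * s i ^+ k].

Lemma bigO_ext_near k F G (e : R) : 0 < e ->
  (forall i, dom i -> 0 < s i < e -> F i = G i) -> bigO k F -> bigO k G.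
Proof.
move=> e0 FG [C [e1 [C0 e10 e11 FC]]]; exists C, (Num.min e e1); split => //.
- by rewrite lt_min e0.
- by rewrite ge_min e11 orbT.
- move=> i di /andP[si]; rewrite lt_min => /andP[se se1].
  by rewrite -FG ?si//; apply: FC => //; rewrite si.
Qed.

Lemma bigO_ext k F G : (forall i, dom i -> 0 < s i -> F i = G i) ->
  bigO k F -> bigO k G.
Proof. by move=> FG; apply: bigO_ext_near (@ltr01 R) _ => i di /andP[si _]; exact: FG. Qed.

Lemma bigO_le k F G : (forall i, dom i -> 0 < s i -> `|F i| <= `|G i|) ->
  bigO k G -> bigO k F.
Proof.
move=> FG [C [e [C0 e0 e1 GC]]]; exists C, e; split => // i di /andP[si se].
by rewrite (le_trans (FG i di si))// GC// si.
Qed.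

Lemma bigO_le_near k F G (e : R) : 0 < e ->
  (forall i, dom i -> 0 < s i < e -> `|F i| <= `|G i|) -> bigO k G -> bigO k F.
Proof.
move=> e0 FG [C [e1 [C0 e10 e11 GC]]]; exists C, (Num.min e e1); split => //.
- by rewrite lt_min e0.
- by rewrite ge_min e11 orbT.
- move=> i di /andP[si]; rewrite lt_min => /andP[se se1].
  by rewrite (le_trans (FG i di _)) ?si// GC// si.
Qed.

Lemma bigO_cst (c : R) : bigO 0 (fun=> c).
Proof. by exists `|c|, 1; split => // i _ _; rewrite expr0 mulr1. Qed.

Lemma bigO_bounded F (C : R) : (forall i, dom i -> `|F i| <= C) -> bigO 0 F.
Proof.
move=> FC; exists `|C|, 1; split => // i di _; rewrite expr0 mulr1.
exact: le_trans (FC i di) (ler_norm _).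
Qed.

Lemma bigO_sX k : bigO k (fun i => s i ^+ k).
Proof.
by exists 1, 1; split => // i _ /andP[si _]; rewrite mul1r normrX gtr0_norm.
Qed.

Lemma bigO_D k F G : bigO k F -> bigO k G -> bigO k (fun i => F i + G i).
Proof.
move=> [C [e [C0 e0 e1 FC]]] [C' [e' [C0' e0' e1' GC]]].
exists (C + C'), (Num.min e e'); split.
- exact: addr_ge0.
- by rewrite lt_min e0.
- by rewrite ge_min e1.
- move=> i di /andP[si]; rewrite lt_min => /andP[se se'].
  rewrite (le_trans (ler_normD _ _))// mulrDl lerD//.
    by apply: FC => //; rewrite si.
  by apply: GC => //; rewrite si.
Qed.

Lemma bigO_N k F : bigO k F -> bigO k (fun i => - F i).
Proof. by apply: bigO_le => i _ _; rewrite normrN. Qed.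

Lemma bigO_B k F G : bigO k F -> bigO k G -> bigO k (fun i => F i - G i).
Proof. by move=> FO /bigO_N; exact: bigO_D. Qed.

Lemma bigO_M j k F G : bigO j F -> bigO k G -> bigO (j + k) (fun i => F i * G i).
Proof.
move=> [C [e [C0 e0 e1 FC]]] [C' [e' [C0' e0' e1' GC]]].
exists (C * C'), (Num.min e e'); split.
- exact: mulr_ge0.
- by rewrite lt_min e0.
- by rewrite ge_min e1.
- move=> i di /andP[si]; rewrite lt_min => /andP[se se'].
  rewrite normrM exprD mulrACA; apply: ler_pM => //.
    by apply: FC => //; rewrite si.
  by apply: GC => //; rewrite si.
Qed.

Lemma bigO_weak j k F : (j <= k)%N -> bigO k F -> bigO j F.
Proof.
move=> jk [C [e [C0 e0 e1 FC]]]; exists C, e; split => // i di /andP[si se].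
rewrite (le_trans (FC i di _)) ?si// ler_wpM2l//.
by rewrite ler_wiXn2l ?(ltW si)// ltW// (lt_le_trans se).
Qed.

Lemma bigO_Mb k F G : bigO 0 F -> bigO k G -> bigO k (fun i => F i * G i).
Proof. by move=> FO GO; have := bigO_M FO GO. Qed.

Lemma bigO_X k m F : bigO k F -> bigO (k * m) (fun i => F i ^+ m).
Proof.
move=> FO; elim: m => [|m IH]; first by rewrite muln0; exact: bigO_cst.
rewrite mulnS; under [fun i => _]eq_fun do rewrite exprS.
exact: bigO_M.
Qed.

Lemma bigO_div j k F : bigO (j + k) F -> bigO k (fun i => F i / s i ^+ j).
Proof.
move=> [C [e [C0 e0 e1 FC]]]; exists C, e; split => // i di /andP[si se].
rewrite normrM normfV normrX (gtr0_norm si) ler_pdivrMr ?exprn_gt0//.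
by rewrite -mulrA -exprD addnC FC// si.
Qed.

Lemma bigO_horner (p : {poly R}) F : bigO 0 F -> bigO 0 (fun i => p.[F i]).
Proof.
move=> FO; elim/poly_ind: p => [|p c IH].
  by under [fun i => _]eq_fun do rewrite horner0; exact: bigO_cst.
under [fun i => _]eq_fun do rewrite hornerD hornerM hornerX hornerC.
by apply: bigO_D; [exact: bigO_Mb|exact: bigO_cst].
Qed.

Lemma bigO_horner_sub (p : {poly R}) k F G : bigO 0 F -> bigO 0 G ->
  bigO k (fun i => F i - G i) -> bigO k (fun i => p.[F i] - p.[G i]).
Proof.
move=> FO GO FG; elim/poly_ind: p => [|p c IH].
  apply: (bigO_ext (F := fun i => 0 * (F i - G i))).
    by move=> i _ _; rewrite !horner0 subrr mul0r.
  by apply: bigO_Mb => //; exact: bigO_cst.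
apply: (bigO_ext (F := fun i => F i * (p.[F i] - p.[G i]) + p.[G i] * (F i - G i))).
  by move=> i _ _; rewrite !hornerE; ring.
by apply: bigO_D; apply: bigO_Mb => //; exact: bigO_horner.
Qed.

Lemma bigO_small F (c : R) : 0 < c -> bigO 1 F ->
  exists2 e : R, 0 < e & forall i, dom i -> 0 < s i < e -> `|F i| < c.
Proof.
move=> c0 [C [e [C0 e0 e1 FC]]].
have C1 : 0 < C + 1 by rewrite ltr_wpDl.
exists (Num.min e (c / (C + 1))); first by rewrite lt_min e0 divr_gt0.
move=> i di /andP[si]; rewrite lt_min => /andP[se sc].
rewrite (le_lt_trans (FC i di _)) ?si// expr1.
rewrite ltr_pdivlMr// mulrC in sc; apply: le_lt_trans sc.
by rewrite ler_wpM2r ?(ltW si)// lerDl.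
Qed.

Lemma bigO_quot (N D N0 D0 : I -> R) (c : R) : 0 < c ->
  bigO 0 N0 -> bigO 0 D0 -> (forall i, dom i -> c <= D0 i) ->
  bigO 1 (fun i => N i - N0 i) -> bigO 1 (fun i => D i - D0 i) ->
  bigO 1 (fun i => N i / D i - N0 i / D0 i).
Proof.
move=> c0 N0O D0O D0c NO DO.
have [e e0 De] := bigO_small (divr_gt0 c0 (ltr0n R 2)) DO.
have Dlow i : dom i -> 0 < s i < e -> c / 2 < D i.
  by move=> di si; have := De i di si; have := D0c i di; rewrite ltr_norml => ? /andP[]; lra.
(* The factor [2 / c ^+ 2] bounds [(D i * D0 i)^-1], because [D0 i >= c] and, near the limit,
   [D i > c / 2]. *)
have : bigO 1 (fun i => (D0 i * (N i - N0 i) - N0 i * (D i - D0 i)) * (2 / c ^+ 2)).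
  under [fun i => _]eq_fun do rewrite mulrC.
  apply: bigO_Mb; first exact: bigO_cst.
  by apply: bigO_B; exact: bigO_Mb.
move=> [C [e' [C0 e0' e1' H]]].
exists C, (Num.min e e'); split => //.
- by rewrite lt_min e0.
- by rewrite ge_min e1' orbT.
- move=> i di /andP[si]; rewrite lt_min => /andP[se se'].
  apply: le_trans (H i di _); last by rewrite si.
  have d0 := D0c i di; have d1 := Dlow i di; rewrite si se in d1.
  have {}d1 := d1 isT.
  have -> : N i / D i - N0 i / D0 i =
     (D0 i * (N i - N0 i) - N0 i * (D i - D0 i)) * (D i * D0 i)^-1.
    by field; rewrite !gt_eqF//; lra.
  rewrite normrM [leRHS]normrM ler_wpM2l//.
  have p1 : 0 < D i * D0 i by rewrite mulr_gt0//; lra.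
  have p2 : 0 < c ^+ 2 / 2 by rewrite divr_gt0// exprn_gt0.
  rewrite -[2 / _]invf_div !gtr0_norm ?invr_gt0// lef_pV2 ?posrE// expr2 mulrAC.
  by apply: ler_pM; lra.
Qed.

End Order.

(** * The approximate zero *)

Section RootPolynomial.
Context {R : realType}.
Implicit Types (p u v P : {poly R}).

Lemma horner_drop2 P (x : R) :
  P.[x] = P`_0 + P`_1 * x + x ^+ 2 * (drop_poly 2 P).[x].
Proof.
rewrite -{1}(poly_take_drop 2 P) hornerD hornerM hornerXn [_ * x ^+ 2]mulrC.
congr (_ + _); rewrite /take_poly horner_poly !big_ord_recl big_ord0 /=.
by ring.
Qed.

Lemma dvdp_comp_sub p u v : (u - v) %| (p \Po u) - (p \Po v).
Proof.
elim/poly_ind: p => [|p c IH].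
  have E w : (0 : {poly R}) \Po w = 0 by rewrite -polyC0 comp_polyC.
  by rewrite !E subrr dvdp0.
rewrite !comp_polyD !comp_polyM !comp_polyX !comp_polyC.
have -> : (p \Po u) * u + c%:P - ((p \Po v) * v + c%:P) =
  ((p \Po u) - (p \Po v)) * u + (p \Po v) * (u - v) by ring.
by apply: dvdp_add; [exact: dvdp_mulr|exact: dvdp_mull].
Qed.

(* The zero near [0] of [2 - (T - tau) * P(rho * tau)], as a function [rho] of
   [tau], is approximated to any order by iterating the fixed-point equation. *)
Lemma root_poly P (a b : R) (n : nat) : 0 < a -> 0 < b ->
  P`_0 = 2 * a -> P`_1 = 2 * b ->
  exists rho s : {poly R}, rho.[0] = a ^+ 2 / b /\
    forall tau : R, 2 - (a^-1 - tau) * P.[rho.[tau] * tau] = tau ^+ n.+1 * s.[tau].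
Proof.
move=> a0 b0 P0 P1.
have an : a != 0 by rewrite gt_eqF.
have bn : b != 0 by rewrite gt_eqF.
pose Q := drop_poly 2 P.
have PE x : P.[x] = 2 * a + 2 * b * x + x ^+ 2 * Q.[x].
  by rewrite horner_drop2 P0 P1.
(* The function equals [tau] times [P(u tau) - tau u^2 Q(u tau) / a - (2 b / a) u]; solving for the
   last [u] produces the factor [k] and the map [Phi]. *)
pose k := a / (2 * b).
pose Phi u := k *: ((P \Po (u * 'X)) - a^-1 *: ('X * u ^+ 2 * (Q \Po (u * 'X)))).
have PhiE u tau : 2 - (a^-1 - tau) * P.[u.[tau] * tau] =
    tau * k^-1 * ((Phi u).[tau] - u.[tau]).
  rewrite /Phi !(hornerE, horner_comp) /= !PE /k.
  by field; rewrite an bn.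
(* [Phi] is a contraction for the ['X]-adic valuation, since [u] enters it only together with a
   factor ['X]. *)
have Phi_dvd u v m : 'X^m %| u - v -> 'X^(m.+1) %| Phi u - Phi v.
  move=> uv; have uvX : 'X^(m.+1) %| u * 'X - v * 'X.
    by rewrite -mulrBl exprSr dvdp_mul.
  have uvX' : 'X^(m.+1) %| 'X * (u - v) by rewrite exprS dvdp_mul.
  rewrite /Phi -scalerBr dvdpZr ?mulf_neq0 ?invr_neq0 ?mulf_neq0//.
  have -> : (P \Po (u * 'X)) - a^-1 *: ('X * u ^+ 2 * (Q \Po (u * 'X))) -
      ((P \Po (v * 'X)) - a^-1 *: ('X * v ^+ 2 * (Q \Po (v * 'X)))) =
      ((P \Po (u * 'X)) - (P \Po (v * 'X))) -
      a^-1 *: (('X * (u - v)) * ((u + v) * (Q \Po (u * 'X))) +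
       ('X * v ^+ 2) * ((Q \Po (u * 'X)) - (Q \Po (v * 'X)))).
    rewrite -!mul_polyC; ring.
  apply: dvdp_sub; first exact: dvdp_trans (dvdp_comp_sub _ _ _).
  rewrite dvdpZr ?invr_neq0//.
  apply: dvdp_add; first exact: dvdp_mulr.
  by apply: dvdp_mull; exact: dvdp_trans (dvdp_comp_sub _ _ _).
(* The value at [0] of [Phi u] for every [u], namely [k * (2 * a)]. *)
pose rho0 := (a ^+ 2 / b)%:P : {poly R}.
have it m : 'X^(m.+1) %| iter m.+1 Phi rho0 - iter m Phi rho0.
  elim: m => [|m IH]; last exact: Phi_dvd.
  rewrite expr1 -['X]subr0 -polyC0 dvdp_XsubCl /root /=; apply/eqP.
  rewrite /rho0 /Phi /k !(hornerE, horner_comp) /= !PE.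
  by field; rewrite an bn.
have itD m : root (iter m Phi rho0 - rho0) 0.
  rewrite -dvdp_XsubCl polyC0 subr0; elim: m => [|m IH]; first by rewrite subrr dvdp0.
  rewrite -(subrK (iter m Phi rho0) (iter m.+1 Phi rho0)) -addrA; apply: dvdp_add => //.
  by apply: dvdp_trans (it m); rewrite exprS dvdp_mulr.
have /dvdpP[s sE] := it n.
exists (iter n Phi rho0), (k^-1 *: ('X * s)); split.
  have := itD n; rewrite /root hornerD hornerN subr_eq0 => /eqP ->.
  by rewrite hornerC.
move=> tau; rewrite PhiE [in RHS]hornerZ [in RHS]hornerM hornerX.
have -> : (Phi (iter n Phi rho0)).[tau] - (iter n Phi rho0).[tau] = s.[tau] * tau ^+ n.+1.
  by rewrite -hornerN -hornerD sE hornerM hornerXn.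
ring.
Qed.
End RootPolynomial.

Section RootFunction.
Context {R : realType}.

Lemma horner_pos_near (p : {poly R}) : 0 < p.[0] ->
  exists2 e : R, 0 < e & forall x, `|x| < e -> 0 < p.[x].
Proof.
move=> p0; have /cvgr_gt/(_ _ p0) [e e0 H] := @continuous_horner R p 0.
exists e => // x xe; apply: H => /=.
by rewrite sub0r normrN.
Qed.

(** Positivity of [p.[T - t]] includes the end points, so the square root has a two-sided derivative
    even there, and the one-sided quotients follow. *)
Lemma C1_sqrt_horner (p : {poly R}) (t0 T : R) :
  (forall t, t0 <= t <= T -> 0 < p.[T - t]) ->
  C1_itv t0 T (fun t => Num.sqrt p.[T - t]).
Proof.
move=> p0; pose dr t := (2 * Num.sqrt p.[T - t])^-1 * - (deriv p).[T - t].
have cTt (t : R) : {for t, continuous (fun t => T - t)}.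
  by apply: cvgB; [exact: cvg_cst|exact: cvg_id].
have cp (q : {poly R}) (t : R) : {for t, continuous (fun t => q.[T - t])}.
  exact: (continuous_cvg _ (@continuous_horner R q (T - t)) (cTt t)).
exists dr.
  apply: continuous_in_subspaceT => t; rewrite inE /= in_itv /= => tt.
  have pt := p0 t tt.
  apply: cvgM; last by apply: cvgN; exact: cp.
  apply: cvgV; first by rewrite mulf_neq0 ?pnatr_eq0// gt_eqF// sqrtr_gt0.
  apply: cvgM; first exact: cvg_cst.
  exact: (continuous_cvg _ (@sqrt_continuous R _) (cp p t)).
move=> t; rewrite /= in_itv /= => tt; have pt := p0 t tt.
have dt : has_deriv (fun t => Num.sqrt p.[T - t]) t (dr t).
  apply: has_deriv_eq.
    apply: (has_deriv_comp (f := Num.sqrt)); first exact: is_derive1_sqrt.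
    apply: (has_deriv_comp (f := horner p)); first exact: has_deriv_horner.
    by apply: has_derivD; [exact: has_deriv_cst|apply: has_derivN; exact: has_deriv_id].
  by rewrite /dr add0r mulrN1.
apply: cvg_within_filter.
apply/cvgr_dnbhsP => u [ut ucvg].
have [/cvg_ex[l dl] dE] := dt.
have {}dE : l = dr t by rewrite -dE; apply/esym/cvg_lim.
subst l; move: dl => /cvgr_dnbhsP/(_ (fun n => u n - t)) H.
have /H : (forall n, u n - t != 0) /\ (u n - t) @[n --> \oo] --> 0.
  by split=> [k|]; [rewrite subr_eq0|exact/subr_cvg0].
apply: cvg_trans; apply: near_eq_cvg; near=> k.
by rewrite /= scaler1 subrK -[LHS]/(_ * _) mulrC.
Unshelve. all: end_near. Qed.
End RootFunction.

(** * The profiles *)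

Section Profile.
Context {R : realType}.
Variables (w0 H0 K : R -> R) (P : {poly R}) (n : nat) (a b c d C : R).
Notation m := (2 * n + 1)%N.
Hypotheses (n_ge1 : (1 <= n)%N) (a0 : 0 < a) (b0 : 0 < b) (c0 : 0 < c).
Hypothesis d0 : 0 < d.
Hypothesis H0E : forall x, `|x| < d -> H0 x = P.[x ^+ 2] + x ^+ m * K x.
Hypothesis Kb : forall x, `|x| < d -> `|K x| <= C * `|x|.
Hypotheses (P0 : P`_0 = 2 * a) (P1 : P`_1 = 2 * b).
Hypothesis w0b : forall x, `|x| < d -> `|w0 x - - 4 * c * x ^+ m| <= C * `|x| ^+ m.+2.
Variables (rho sp : {poly R}) (t0 : R).
Hypothesis rho0 : rho.[0] = a ^+ 2 / b.
Hypothesis rhoE : forall tau : R,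
  2 - (a^-1 - tau) * P.[rho.[tau] * tau] = tau ^+ n.+1 * sp.[tau].
Notation T := (a^-1).
Hypothesis t00 : 0 < t0.
Hypothesis rho_gt0 : forall t, t0 <= t <= T -> 0 < rho.[T - t].
Variable M : R.

Let r (t : R) : R := Num.sqrt rho.[T - t].
(** Rescaled variables at [i = (t, x)]: [sg] is the small parameter, [z] the argument of the
    profiles, and [y] stands for [x / sg]. As [n >= 1], [y] differs from [r] by [O(sg)]. *)
Let sg (i : R * R) : R := Num.sqrt (T - i.1).
Let dom (i : R * R) := t0 <= i.1 < T /\ `|i.2 - r i.1 * sg i| <= M * (T - i.1) ^+ n.
Let rr (i : R * R) : R := r i.1.
Let z (i : R * R) : R := (i.2 - rr i * sg i) / (T - i.1) ^+ n.
Let y (i : R * R) : R := rr i + z i * sg i ^+ (2 * n - 1).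
Let sb : R := Num.sqrt b.
Let rs : R := a / sb.

Let sb0 : 0 < sb. Proof. by rewrite sqrtr_gt0. Qed.
Let sb2 : sb ^+ 2 = b. Proof. by rewrite sqr_sqrtr// ltW. Qed.
Let rs0 : 0 < rs. Proof. by rewrite divr_gt0. Qed.
Let rs2 : rs ^+ 2 = rho.[0]. Proof. by rewrite rho0 expr_div_n sb2. Qed.
Let T0 : 0 < T. Proof. by rewrite invr_gt0. Qed.

Let dom_tau i : dom i -> 0 < T - i.1.
Proof. by case=> /andP[_ iT] _; rewrite subr_gt0. Qed.

Let sg_gt0 i : dom i -> 0 < sg i.
Proof. by move=> /dom_tau ?; rewrite sqrtr_gt0. Qed.

Let sg2 i : dom i -> sg i ^+ 2 = T - i.1.
Proof. by move=> /dom_tau ?; rewrite sqr_sqrtr// ltW. Qed.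

Let rr_gt0 i : dom i -> 0 < rr i.
Proof.
by move=> [/andP[h1 h2] _]; rewrite sqrtr_gt0; apply: rho_gt0; rewrite h1 ltW.
Qed.

Let rr2 i : dom i -> rr i ^+ 2 = rho.[sg i ^+ 2].
Proof.
move=> di; rewrite sg2// sqr_sqrtr// ltW//; case: di => /andP[h1 h2] _.
by apply: rho_gt0; rewrite h1 ltW.
Qed.

Let zE i : dom i -> i.2 = rr i * sg i + z i * sg i ^+ (2 * n).
Proof.
move=> di; rewrite exprM sg2// /z divfK; last by rewrite expf_neq0// gt_eqF// dom_tau.
by rewrite addrC subrK.
Qed.

Let xE i : dom i -> i.2 = sg i * y i.
Proof.
move=> di; rewrite [LHS]zE// /y.
have -> : sg i ^+ (2 * n) = sg i * sg i ^+ (2 * n - 1).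
  by rewrite -exprS; congr (_ ^+ _); clear - n_ge1; lia.
by ring.
Qed.

Let bO := bigO dom sg.

Let z_O : bO 0 z.
Proof.
apply: (@bigO_bounded _ _ dom sg _ M) => i di; have ti := dom_tau di.
rewrite normrM normfV normrX (gtr0_norm ti) ler_pdivrMr ?exprn_gt0//.
by case: di.
Qed.

Let t_O : bO 0 (fun i => i.1).
Proof.
apply: (@bigO_bounded _ _ dom sg _ T) => i [/andP[h1 h2] _].
by rewrite gtr0_norm ?ltW// (lt_le_trans t00).
Qed.

Let tT_O : bO 2 (fun i => i.1 - T).
Proof.
apply: (bigO_le (G := fun i => sg i ^+ 2)); last exact: bigO_sX.
by move=> i di _; rewrite sg2// distrC.
Qed.

Let sg_O k : bO k (fun i => sg i ^+ k).
Proof. exact: bigO_sX. Qed.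

Let sg2_O : bO 0 (fun i => sg i ^+ 2).
Proof. exact: bigO_weak (sg_O 2). Qed.

Let rrs_O : bO 1 (fun i => rr i - rs).
Proof.
(* The square root needs no expansion: [r - rs] is [(r^2 - rs^2) / (r + rs)], and [r + rs >= rs]. *)
apply: (bigO_le (G := fun i => rs^-1 * (rho.[sg i ^+ 2] - rho.[0]))).
  move=> i di _; have ri := rr_gt0 di; have rsp := rs0.
  rewrite -rr2// -rs2 subr_sqr normrM (gtr0_norm (x := rs^-1)) ?invr_gt0// normrM.
  rewrite mulrCA ler_peMr// [`|rr i + rs|]gtr0_norm ?addr_gt0//.
  by rewrite mulrC ler_pdivlMr//; lra.
apply: bigO_Mb; first exact: bigO_cst.
apply: bigO_horner_sub => //; first exact: bigO_cst.
apply: (bigO_ext (F := fun i => sg i ^+ 2)); first by move=> i _ _; rewrite subr0.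
exact: (bigO_weak _ (sg_O 2)).
Qed.

Let add_back k F G : bO k (fun i => F i - G i) -> bO k G -> bO k F.
Proof.
move=> FG GO; apply: (bigO_ext (F := fun i => (F i - G i) + G i)).
  by move=> i _ _; rewrite subrK.
exact: bigO_D.
Qed.

Let rr_O : bO 0 rr.
Proof. exact: (add_back (bigO_weak _ rrs_O) (bigO_cst _ _ rs)). Qed.

Let y_rs_O : bO 1 (fun i => y i - rs).
Proof.
apply: (bigO_ext (F := fun i => (rr i - rs) + z i * sg i ^+ (2 * n - 1))).
  by move=> i _ _; rewrite /y; ring.
apply: bigO_D => //; apply: bigO_Mb => //.
apply: bigO_weak (sg_O _); clear - n_ge1; lia.
Qed.

Let y_O : bO 0 y.
Proof. exact: (add_back (bigO_weak _ y_rs_O) (bigO_cst _ _ rs)). Qed.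

Let x_O : bO 1 (fun i => i.2).
Proof.
apply: (bigO_ext (F := fun i => y i * sg i ^+ 1)).
  by move=> i di _; rewrite [RHS]xE// mulrC expr1.
by apply: bigO_Mb; [exact: y_O|exact: sg_O].
Qed.

Let x_small : exists2 e : R, 0 < e & forall i, dom i -> 0 < sg i < e -> `|i.2| < d.
Proof. exact: (bigO_small d0 x_O). Qed.

(** With [X] below, the denominator of the explicit formulas becomes [sg^(2 m) (X^2 + W^2)]. The
    limit [W0] is a nonzero constant, which keeps the rescaled denominator away from [0] for all
    [z]. *)
Let W (i : R * R) : R := i.1 * w0 i.2 / sg i ^+ m.
Let W0 : R := T * (- 4 * c) * rs ^+ m.

Let xX_O k : bO k (fun i => i.2 ^+ k).
Proof. by have := bigO_X k x_O; rewrite mul1n. Qed.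

Let W_O : bO 1 (fun i => W i - W0).
Proof.
have [e e0 xd] := x_small.
apply: (bigO_ext (F := fun i => i.1 * ((w0 i.2 - - 4 * c * i.2 ^+ m) / sg i ^+ m) +
    - 4 * c * (i.1 * (y i ^+ m - rs ^+ m) + (i.1 - T) * rs ^+ m))).
  move=> i di si; have sgn : sg i ^+ m != 0 by rewrite expf_neq0// gt_eqF.
  have -> : i.2 ^+ m = sg i ^+ m * y i ^+ m by rewrite {1}xE// exprMn.
  by rewrite /W /W0; field; rewrite sgn gt_eqF.
apply: bigO_D.
  apply: bigO_Mb => //; apply: bigO_div; apply: (bigO_weak (k := m.+2)).
    by clear; lia.
  apply: (bigO_le_near (e := e) (G := fun i => C * i.2 ^+ m.+2)) => //.
    move=> i di si; rewrite (le_trans (w0b (xd i di si)))// normrM normrX.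
    by rewrite ler_wpM2r ?exprn_ge0// ler_norm.
  by apply: bigO_Mb; [exact: bigO_cst|exact: xX_O].
apply: bigO_Mb; first exact: bigO_cst.
apply: bigO_D.
  apply: bigO_Mb => //.
  have := bigO_horner_sub 'X^m y_O (bigO_cst dom sg rs) y_rs_O.
  by apply: bigO_ext => i _ _; rewrite !hornerXn.
apply: (bigO_ext (F := fun i => rs ^+ m * (i.1 - T))); first by move=> *; rewrite mulrC.
by apply: bigO_Mb; [exact: bigO_cst|exact: (bigO_weak _ tT_O)].
Qed.

Let X (i : R * R) : R := (2 - i.1 * H0 i.2) / sg i ^+ m.
Let X0 (i : R * R) : R := - (4 * sb * z i).

Let Q := drop_poly 2 P.
Let PE x : P.[x] = 2 * a + 2 * b * x + x ^+ 2 * Q.[x].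
Proof. by rewrite horner_drop2 P0 P1. Qed.

(** [u] is the square of [x] and [v] the square of the approximate zero [r s], the point at which
    [rhoE] evaluates [P]. *)
Let u (i : R * R) : R := i.2 ^+ 2.
Let v (i : R * R) : R := rho.[sg i ^+ 2] * sg i ^+ 2.

Let u_O : bO 2 u. Proof. exact: xX_O. Qed.

Let v_O : bO 2 v.
Proof. by apply: bigO_Mb; [exact: bigO_horner|exact: sg_O]. Qed.

Let uvE i : dom i -> u i - v i = (z i * (y i + rr i)) * sg i ^+ m.
Proof.
move=> di; rewrite /u /v -rr2// -exprMn subr_sqr addn1 exprSr.
have -> : i.2 - rr i * sg i = z i * sg i ^+ (2 * n) by rewrite {1}zE//; ring.
by rewrite {1}xE//; ring.
Qed.

Let uv_O : bO m (fun i => u i - v i).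
Proof.
apply: (bigO_ext (F := fun i => (z i * (y i + rr i)) * sg i ^+ m)).
  by move=> i di _; rewrite uvE.
by apply: bigO_Mb; [apply: bigO_Mb => //; exact: bigO_D|exact: sg_O].
Qed.

Let uvQ_O : bO m.+1 (fun i => u i ^+ 2 * Q.[u i] - v i ^+ 2 * Q.[v i]).
Proof.
have uO := bigO_weak (leq0n 2) u_O; have vO := bigO_weak (leq0n 2) v_O.
apply: (bigO_ext (F := fun i => Q.[u i] * ((u i + v i) * (u i - v i)) +
    v i ^+ 2 * (Q.[u i] - Q.[v i]))).
  by move=> i _ _; ring.
apply: bigO_D.
  apply: bigO_Mb; first exact: bigO_horner.
  apply: (bigO_weak (k := 2 + m)); first by clear; lia.
  by apply: bigO_M => //; exact: bigO_D.
apply: (bigO_weak (k := 2 * 2 + m)); first by clear; lia.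
by apply: bigO_M; [exact: bigO_X|exact: bigO_horner_sub].
Qed.

(** From [2 - t H0 = (2 - t P(v)) - t (P(u) - P(v)) - t x^m K]. The outer terms and the part of [P]
    beyond the linear one are [O(sg^(m+1))]. The linear part gives [- 2 b t z (y + r) sg^m], with
    coefficient tending to [- 4 b T rs z = - 4 sb z]. *)
Let X_O : bO 1 (fun i => X i - X0 i).
Proof.
have [e e0 xd] := x_small.
apply: (bigO_ext_near (e := e) (F := fun i =>
    (sg i ^+ (2 * n.+1) * sp.[sg i ^+ 2] - i.1 * (i.2 ^+ m * K i.2) -
     i.1 * (u i ^+ 2 * Q.[u i] - v i ^+ 2 * Q.[v i])) / sg i ^+ m +
    (- (2 * b) * (z i * ((i.1 - T) * (y i + rr i) + T * ((y i - rs) + (rr i - rs))))))) => //.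
  move=> i di si.
  have sgn : sg i ^+ m != 0 by rewrite expf_neq0// gt_eqF//; case/andP: si.
  rewrite exprM -rhoE sg2// -sg2// -/(v i).
  have -> : a^-1 - sg i ^+ 2 = i.1 by rewrite sg2//; ring.
  rewrite /X H0E ?xd// -/(u i) /X0 !PE.
  have uv := uvE di.
  have -> : b = sb ^+ 2 by [].
  have -> : u i = v i + z i * (y i + rr i) * sg i ^+ m by rewrite -uv; ring.
  by rewrite /rs; field; rewrite sgn !gt_eqF.
apply: bigO_D.
  apply: bigO_div; rewrite addn1; apply: bigO_B; last by apply: bigO_Mb.
  apply: bigO_B.
    have -> : (m.+1 = 2 * n.+1)%N by clear; lia.
    apply: (bigO_ext (F := fun i => sp.[sg i ^+ 2] * sg i ^+ (2 * n.+1))).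
      by move=> *; rewrite mulrC.
    by apply: bigO_Mb; [exact: bigO_horner|exact: sg_O].
  apply: bigO_Mb => //; rewrite -addn1; apply: bigO_M; first exact: xX_O.
  apply: (bigO_le_near (e := e) (G := fun i => C * i.2)) => //.
    move=> i di si; rewrite (le_trans (Kb (xd i di si)))// normrM.
    by rewrite ler_wpM2r// ler_norm.
  by apply: bigO_Mb => //; exact: bigO_cst.
apply: bigO_Mb; first exact: bigO_cst.
apply: bigO_Mb => //; apply: bigO_D; last first.
  by apply: bigO_Mb; [exact: bigO_cst|exact: bigO_D].
apply: (bigO_ext (F := fun i => (y i + rr i) * (i.1 - T))); first by move=> *; rewrite mulrC.
by apply: bigO_Mb; [exact: bigO_D|exact: (bigO_weak _ tT_O)].
Qed.

Let X0_O : bO 0 X0.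
Proof.
apply: bigO_N; apply: bigO_Mb => //; exact: bigO_cst.
Qed.

Let X_O0 : bO 0 X. Proof. exact: (add_back (bigO_weak _ X_O) X0_O). Qed.

Let W_O0 : bO 0 W. Proof. exact: (add_back (bigO_weak _ W_O) (bigO_cst _ _ W0)). Qed.

Let D (i : R * R) : R := X i ^+ 2 + W i ^+ 2.
Let D0 (i : R * R) : R := X0 i ^+ 2 + W0 ^+ 2.

Let D_O : bO 1 (fun i => D i - D0 i).
Proof.
apply: (bigO_ext (F := fun i => (X i + X0 i) * (X i - X0 i) + (W i + W0) * (W i - W0))).
  by move=> i _ _; rewrite /D /D0; ring.
by apply: bigO_D; apply: bigO_Mb => //; apply: bigO_D => //; exact: bigO_cst.
Qed.

Let D0_O : bO 0 D0.
Proof.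
apply: bigO_D; last exact: bigO_cst.
by have := bigO_X 2 X0_O; rewrite mul0n.
Qed.

Let W02 : 0 < W0 ^+ 2.
Proof.
by rewrite exprn_even_gt0//= !mulf_neq0 ?oppr_eq0 ?pnatr_eq0 ?expf_neq0// gt_eqF.
Qed.

Let D0_ge i : dom i -> W0 ^+ 2 <= D0 i.
Proof. by move=> _; rewrite lerDr sqr_ge0. Qed.

Let tV_O : bO 1 (fun i => i.1^-1 - a).
Proof.
have := @bigO_quot R _ dom sg (fun=> 1) (fun i => i.1) (fun=> 1) (fun=> T) T T0.
have -> : (fun i : R * R => 1 / i.1 - 1 / a^-1) = (fun i => i.1^-1 - a).
  by apply/funext => i; rewrite !div1r invrK.
apply; [exact: bigO_cst|exact: bigO_cst|by []| |exact: (bigO_weak _ tT_O)].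
under [fun i => _]eq_fun do rewrite subrr.
apply: (bigO_ext (F := fun i => 0 * sg i ^+ 1)); first by move=> *; rewrite mul0r.
by apply: bigO_Mb; [exact: bigO_cst|exact: sg_O].
Qed.

Let tV_O0 : bO 0 (fun i => i.1^-1).
Proof. exact: (add_back (bigO_weak _ tV_O) (bigO_cst _ _ a)). Qed.

Let den (i : R * R) : R := (2 - i.1 * H0 i.2) ^+ 2 + i.1 ^+ 2 * w0 i.2 ^+ 2.

Let denE i : dom i -> (den i)^-1 = (D i)^-1 * sg i ^- m * sg i ^- m.
Proof.
move=> di; have sgn : sg i ^+ m != 0 by rewrite expf_neq0// gt_eqF// sg_gt0.
rewrite -mulrA -!invfM; congr (_^-1).
by rewrite /den /D /X /W; field.
Qed.

Let sbm : sb ^+ m != 0.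
Proof. by rewrite expf_neq0// gt_eqF. Qed.

Let D0E i : D0 i = 16 * (sb ^+ m.*2)^-1 *
  (a ^+ (4 * n) * c ^+ 2 + b ^+ (2 * n + 2) * z i ^+ 2).
Proof.
have -> : b ^+ (2 * n + 2) = sb ^+ m * sb ^+ m * sb ^+ 2.
  by rewrite -sb2 -exprM -!exprD; congr (_ ^+ _); clear; lia.
have -> : a ^+ (4 * n) = a ^+ (2 * n) * a ^+ (2 * n).
  by rewrite -exprD; congr (_ ^+ _); clear; lia.
rewrite -addnn exprD /D0 /X0 /W0 /rs expr_div_n [a ^+ m]exprD expr1.
have an : a != 0 by rewrite gt_eqF.
by move: (sb ^+ m) sbm => s sn; field; rewrite sn an.
Qed.

Let powRb k : b `^ (k%:R / 2) = sb ^+ k.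
Proof. by rewrite mulrC powRrM powR_mulrn ?powR_ge0// powR12_sqrt// ltW. Qed.

Let OmegaE i : (4 * W0 * a) / D0 i = Omega2 a b c n (z i).
Proof.
rewrite D0E /Omega2 powRb.
move: (_ + _ * z i ^+ 2) => E; rewrite !invfM invrK.
rewrite -addnn exprD /W0 /rs expr_div_n [a ^+ m]exprD expr1.
have an : a != 0 by rewrite gt_eqF.
by move: (E^-1) (sb ^+ m) sbm => Ei s sn; field; rewrite sn an.
Qed.

Let HOmegaE i : (4 * a * X0 i) / D0 i =
  - (a * b `^ ((4 * n + 3)%:R / 2) * z i
     / (a ^+ (4 * n) * c ^+ 2 + b ^+ (2 * n + 2) * z i ^+ 2)).
Proof.
rewrite D0E powRb /X0.
have -> : sb ^+ (4 * n + 3) = sb * sb ^+ m.*2.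
  by rewrite -exprS; congr (_ ^+ _); rewrite -addnn; clear; lia.
move: (_ + _ * z i ^+ 2) => E; rewrite !invfM invrK.
by move: (E^-1) (sb ^+ m.*2) => Ei s; field.
Qed.

(** Since [w0 = W sg^m / t], the rescaled solution is [4 W t^-1 / D], and [t^-1] tends to [a]. *)
Lemma omega_bigO : bO 1 (fun i =>
  4 * w0 i.2 / den i * sg i ^+ m - Omega2 a b c n (z i)).
Proof.
have : bO 1 (fun i => (4 * W i * i.1^-1) / D i - (4 * W0 * a) / D0 i).
  apply: (bigO_quot W02) => //; first exact: bigO_cst.
  apply: (bigO_ext (F := fun i => 4 * (W i * (i.1^-1 - a) + a * (W i - W0)))).
    by move=> i _ _; ring.
  apply: bigO_Mb; first exact: bigO_cst.
  by apply: bigO_D; apply: bigO_Mb => //; exact: bigO_cst.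
apply: bigO_ext => i di _; rewrite OmegaE; congr (_ - _).
have sgn : sg i ^+ m != 0 by rewrite expf_neq0// gt_eqF// sg_gt0.
have tn : i.1 != 0 by case: di => /andP[h1 _] _; rewrite gt_eqF// (lt_le_trans t00).
by rewrite denE// /W; move: (D i)^-1 => Di; field; rewrite sgn tn.
Qed.

(** After rescaling, the numerator is [2 H0 X - 2 t^-1 W^2 sg^m]: the square of [w0] carries an
    additional [sg^m] and drops out, while [H0] tends to [2 a]. *)
Lemma hilbert_omega_bigO : bO 1 (fun i =>
  (2 * H0 i.2 * (2 - i.1 * H0 i.2) - 2 * i.1 * w0 i.2 ^+ 2) / den i * sg i ^+ m -
  - (a * b `^ ((4 * n + 3)%:R / 2) * z i
     / (a ^+ (4 * n) * c ^+ 2 + b ^+ (2 * n + 2) * z i ^+ 2))).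
Proof.
have [e e0 xd] := x_small.
have H0O : bO 1 (fun i => H0 i.2 - 2 * a).
  apply: (bigO_ext_near (e := e) (F := fun i =>
    u i * (2 * b + u i * Q.[u i]) + i.2 ^+ m * K i.2)) => //.
    by move=> i di si; rewrite H0E ?xd// PE /u; ring.
  apply: (bigO_weak (k := 2)) => //; apply: bigO_D.
    under [fun i => _]eq_fun do rewrite mulrC.
    apply: bigO_Mb => //; apply: bigO_D; first exact: bigO_cst.
    have uO := bigO_weak (leq0n 2) u_O.
    by apply: bigO_Mb => //; exact: bigO_horner.
  apply: (bigO_weak (k := m + 1)); first by clear - n_ge1; lia.
  apply: bigO_M; first exact: xX_O.
  apply: (bigO_le_near (e := e) (G := fun i => C * i.2)) => //.
    move=> i di si; rewrite (le_trans (Kb (xd i di si)))// normrM.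
    by rewrite ler_wpM2r// ler_norm.
  by apply: bigO_Mb => //; exact: bigO_cst.
have : bO 1 (fun i => (2 * H0 i.2 * X i - 2 * (i.1^-1 * W i ^+ 2) * sg i ^+ m) / D i -
    (4 * a * X0 i) / D0 i).
  apply: (bigO_quot W02) => //; first by apply: bigO_Mb => //; exact: bigO_cst.
  apply: (bigO_ext (F := fun i => 2 * (X i * (H0 i.2 - 2 * a)) +
      4 * a * (X i - X0 i) - 2 * (i.1^-1 * W i ^+ 2) * sg i ^+ m)).
    by move=> i _ _; ring.
  apply: bigO_B.
    apply: bigO_D; last by apply: bigO_Mb => //; exact: bigO_cst.
    by apply: bigO_Mb; [exact: bigO_cst|exact: bigO_Mb].
  apply: bigO_Mb; last by apply: (bigO_weak _ (sg_O m)); rewrite addn1.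
  apply: bigO_Mb; first exact: bigO_cst.
  by apply: bigO_Mb => //; have := bigO_X 2 W_O0; rewrite mul0n.
apply: bigO_ext => i di _; rewrite HOmegaE; congr (_ - _).
have sgn : sg i ^+ m != 0 by rewrite expf_neq0// gt_eqF// sg_gt0.
have tn : i.1 != 0 by case: di => /andP[h1 _] _; rewrite gt_eqF// (lt_le_trans t00).
by rewrite denE// /W /X; move: (D i)^-1 => Di; field; rewrite sgn tn.
Qed.

End Profile.

Lemma profile_of_bigO (R : realType) (t0 T : R) (n : nat) (r : R -> R)
    (w : R -> R -> R) (U : R -> R) :
  t0 < T ->
  (forall M : R, bigO
    (fun i : R * R => t0 <= i.1 < T /\
      `|i.2 - r i.1 * Num.sqrt (T - i.1)| <= M * (T - i.1) ^+ n)
    (fun i : R * R => Num.sqrt (T - i.1)) 1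
    (fun i => w i.2 i.1 * Num.sqrt (T - i.1) ^+ (2 * n + 1) -
      U ((i.2 - r i.1 * Num.sqrt (T - i.1)) / (T - i.1) ^+ n))) ->
  profile_asymptotics t0 T n r w U.
Proof.
move=> t0T H M _; have [C [e [C0 e0 _ HC]]] := H M.
have e2 : 0 < e ^+ 2 by rewrite exprn_gt0.
(* [C] is only known to be nonnegative, whence [C + 1]; from [T - t <= e ^+ 2 / 2] the parameter is
   strictly below [e]. *)
exists (C + 1), (Num.max t0 (T - e ^+ 2 / 2)); split.
- by rewrite ltr_wpDl.
- by rewrite le_max lexx.
- by rewrite gt_max t0T; lra.
move=> t x /andP[]; rewrite ge_max => /andP[tt te] tT.
have tp : 0 < T - t by rewrite subr_gt0.
have sE : (T - t) `^ (1 / 2) = Num.sqrt (T - t) by rewrite div1r powR12_sqrt// ltW.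
have smE : (T - t) `^ ((2 * n + 1)%:R / 2) = Num.sqrt (T - t) ^+ (2 * n + 1).
  by rewrite mulrC powRrM powR_mulrn ?powR_ge0// powR12_sqrt// ltW.
rewrite sE smE => xM.
have s0 : 0 < Num.sqrt (T - t) by rewrite sqrtr_gt0.
have se : Num.sqrt (T - t) < e.
  by rewrite -(ltr_pXn2r (n := 2))// ?nnegrE ?ltW// sqr_sqrtr ?ltW//; lra.
exists (w x t * Num.sqrt (T - t) ^+ (2 * n + 1) -
      U ((x - r t * Num.sqrt (T - t)) / (T - t) ^+ n)).
  have := HC (t, x) _; rewrite /= s0 se tt tT xM expr1 => /(_ (conj isT isT) isT) /le_trans.
  by apply; rewrite ler_wpM2r ?ltW// ltrDl.
by rewrite [U _ + _]addrC subrK div1r mulrCA mulVf ?mulr1// expf_neq0// gt_eqF.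
Qed.

Theorem theorem2p3 (R : realType) (w0 : R -> R) (n : nat) (delta : R)
  (w0_H1 : sobolev_H1 w0)
  (w0_odd : forall x : R, w0 (- x) = - w0 x)
  (w0_zero : forall x : R, w0 x = 0 <-> x = 0)
  (w0_sgn : forall x : R, Num.sg (w0 x) = - Num.sg x)
  (n_ge1 : (1 <= n)%N)
  (delta_gt0 : 0 < delta)
  (w0_Ck : Ck_on (2 * n + 3) `]- delta, delta[ w0)
  (w0_flat : forall k : nat, (k <= 2 * n)%N -> w0^`(k) 0 = 0)
  (w0_lead : w0^`(2 * n + 1) 0 < 0) :
  [/\ 0 < hilbert w0 0,
      0 < (hilbert w0)^`(2) 0 &
      forall a b c : R,
        hilbert w0 0 = 2 * a ->
        (hilbert w0)^`(2) 0 = 4 * b ->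
        w0^`(2 * n + 1) 0 = - 4 * c * ((2 * n + 1)`!)%:R ->
        [/\ 0 < a, 0 < b, 0 < c,
            (forall z : R,
               hilbert (Omega2 a b c n) z =
               - (a * b `^ ((4 * n + 3)%:R / 2) * z
                  / (a ^+ (4 * n) * c ^+ 2 + b ^+ (2 * n + 2) * z ^+ 2))) &
            let T := 1 / a in
            forall w : R -> R -> R, clm_solution w0 T w ->
            exists (t0 : R) (r : R -> R),
              [/\ 0 < t0 < T,
                  C1_itv t0 T r,
                  r T = a / b `^ (1 / 2),
                  profile_asymptotics t0 T n r w (Omega2 a b c n) &
                  profile_asymptotics t0 T n r
                    (fun x t : R => hilbert (w^~ t) x)
                    (hilbert (Omega2 a b c n))]]].
Proof.
have [w0c w0L2 _] := w0_H1.
have w0_neg x : 0 < x -> w0 x < 0.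
  by move=> x0; rewrite -sgr_lt0 w0_sgn gtr0_sg// oppr_lt0 ltr01.
have [P [K [d [C [[d0 C0] HE [K0 dK] [P0 P1] w0b]]]]] :=
  hilbert_local_expansion w0c w0L2 w0_odd w0_neg n_ge1 delta_gt0 w0_Ck w0_flat.
have Kb := has_deriv_lip0 K0 C0 dK.
have H00 : hilbert w0 0 = P`_0.
  rewrite HE ?normr0// expr0n /= horner_coef0 addn1 expr0n /= mul0r.
  by rewrite addr0.
have H20 : derive1n 2 (hilbert w0) 0 = 2 * P`_1 by exact: second_derivative HE K0 C0 dK.
split; [by rewrite H00|by rewrite H20 mulr_gt0|].
move=> a b c Ha Hb Hc.
have P0E : P`_0 = 2 * a by rewrite -H00.
have P1E : P`_1 = 2 * b.
  have : 2 * P`_1 = 4 * b by rewrite -H20.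
  lra.
have a0 : 0 < a by lra.
have b0 : 0 < b by lra.
have f0 : 0 < (2 * n + 1)`!%:R :> R by rewrite ltr0n fact_gt0.
have c0 : 0 < c by move: w0_lead; rewrite Hc; nra.
have kE : derive1n (2 * n + 1) w0 0 / (2 * n + 1)`!%:R = - 4 * c.
  by rewrite Hc mulfK// gt_eqF.
rewrite kE in w0b.
have hO z := hilbert_Omega2 n z a0 b0 c0.
split => // T; have TE : T = a^-1 by rewrite /T div1r.
move: T TE => _ -> w [_ _ wE wHE].
have T0 : 0 < a^-1 by rewrite invr_gt0.
have [rho [sp [rho0 rhoE]]] := root_poly n a0 b0 P0E P1E.
have [e e0 rhoe] : exists2 e : R, 0 < e & forall x, `|x| < e -> 0 < rho.[x].
  by apply: horner_pos_near; rewrite rho0 divr_gt0// exprn_gt0.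
(* The first bound keeps [t0] positive, the second keeps [rho] positive on all of [[0, T - t0]]. *)
pose t0 := Num.max (a^-1 / 2) (a^-1 - e / 2).
have t00 : 0 < t0 by rewrite lt_max divr_gt0.
have t0T : t0 < a^-1 by rewrite gt_max; apply/andP; split; lra.
have rho_gt0 t : t0 <= t <= a^-1 -> 0 < rho.[a^-1 - t].
  rewrite ge_max => /andP[/andP[h1 h2] h3]; apply: rhoe.
  by rewrite ger0_norm; lra.
exists t0, (fun t => Num.sqrt rho.[a^-1 - t]); split.
- by rewrite t00.
- exact: C1_sqrt_horner.
- rewrite subrr rho0 div1r powR12_sqrt ?ltW// sqrtrM ?sqr_ge0// sqrtr_sqr.
  by rewrite gtr0_norm// sqrtrV ?ltW.
- apply: profile_of_bigO => // M.
  have := omega_bigO n_ge1 a0 b0 c0 d0 HE Kb P0E P1E w0b rho0 rhoE t00 rho_gt0 M.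
  apply: bigO_ext => i [/andP[h1 h2] _] _.
  by rewrite wE // h2 andbT ltW// (lt_le_trans t00).
- apply: profile_of_bigO => // M.
  have := hilbert_omega_bigO n_ge1 a0 b0 c0 d0 HE Kb P0E P1E w0b rho0 rhoE t00 rho_gt0 M.
  apply: bigO_ext => i [/andP[h1 h2] _] _.
  by rewrite hO wHE // h2 andbT ltW// (lt_le_trans t00).
Qed.
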